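(* Let $G$ be a locally finite, connected graph. Then $G$ is chordal if and only if $G$ admits a canonical tree-decomposition into cliques. More precisely, if $G$ is chordal, then $\mathcal{T}(G)$ is a canonical tree-decomposition of $G$ into cliques.
   Context: Graphs are simple; a graph is locally finite if all its vertices have finite degree, and chordal if every cycle of length at least four has a chord. A clique is a vertex set inducing a complete subgraph; a maximal clique is an inclusion-maximal one. $\mathrm{Aut}(G)$ is the automorphism group of $G$. **Separations.** A separation of a graph $G$ is an unordered pair $\{A,B\}$ with $A\cup B=V(G)$ and no edge between $A\setminus B$ and $B\setminus A$. Its separator is $A\cap B$, its order is $|A\cap B|$; a $k$-separation is one of order $k$. It is proper if $A\setminus B$ and $B\setminus A$ are non-empty. It is tight if each of $A\setminus B$ and $B\setminus A$ contains the vertex set of a component $C$ of $G-(A\cap B)$ with $N_G(C)=A\cap B$. Its orientations are $(A,B)$ and $(B,A)$. Write $(A,B)\le(C,D)$ if $A\subseteq C$ and $B\supseteq D$. Two separations are nested if they have comparable orientations, and otherwise they cross; a set of separations is nested if its elements are pairwise nested. A set $S$ of separations is point-finite if every vertex lies in the separators of only finitely many elements of $S$. It is $\mathrm{Aut}(G)$-invariant if $\{\phi(A),\phi(B)\}\in S$ for all $\{A,B\}\in S$, $\phi\in\mathrm{Aut}(G)$. A separation $\{A,B\}$ distinguishes vertex sets $X,Y$ if, up to renaming sides, $X\subseteq A$ and $Y\subseteq B$, and it does so efficiently if it has minimum order among all such separations. **Tree-decompositions.** A tree-decomposition of $G$ is a pair $(T,\mathcal V)$ of a tree $T$ and a family $\mathcal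 V=(V_t)_{t\in V(T)}$ of vertex sets (bags) with $G=\bigcup_t G[V_t]$ and such that for every vertex $v$ the subgraph of $T$ induced on $\{t:v\in V_t\}$ is connected. Each edge $f=t_1t_2$ of $T$ induces the separation $s^f=\{A_1^f,A_2^f\}$, where $A_i^f$ is the union of the bags $V_t$ over all $t$ in the component of $T-f$ containing $t_i$. $(T,\mathcal V)$ is canonical if there is an action of $\mathrm{Aut}(G)$ on $T$ with $V_{\phi\cdot t}=\phi(V_t)$ for all $t\in V(T)$, $\phi\in\mathrm{Aut}(G)$. It is into cliques if every bag is a clique of $G$. **$\mathcal T(N)$.** Let $N$ be a nested set of proper separations of a connected graph. $\mathcal T(N)=(T,\mathcal V)$ is the following standard construction. An orientation $O$ of $N$ contains exactly one orientation of each element of $N$; it is consistent if there are no $(A,B),(C,D)\in O$ with $\{A,B\}\ne\{C,D\}$ and $(B,A)\le(C,D)$. The nodes of $T$ are the sets $\sigma$ of $\le$-maximal elements of those consistent orientations $O$ of $N$ in which every element lies below a maximal element. The edges of $T$ correspond to the elements of $N$: $\{A,B\}$ joins the node containing $(A,B)$ to the node containing $(B,A)$. The bag of $\sigma$ is $\bigcap_{(A,B)\in\sigma}B$ (and is $V(G)$ if $\sigma=\emptyset$). If $N$ is point-finite, $\mathcal T(N)$ is a tree-decomposition with $f\mapsto s^f$ a bijection $E(T)\to N$, and it is canonical if $N$ is $\mathrm{Aut}(G)$-invariant. **Bottlenecks (treated as a black box).** For each $k\in\mathbb N$ the $k$-bottlenecks in a graph $G$ are certain sets of $k$-separations of $G$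 (notion of Jacobs, Knappe and Kurkofka). The following known facts about this notion are to be taken as given; the statement may be read for any fixed notion with these properties. (B1) Every $k$-bottleneck is a non-empty set of $k$-separations, and automorphisms of $G$ map $k$-bottlenecks to $k$-bottlenecks. (B2) If $X,Y$ are distinct maximal cliques of a locally finite chordal graph such that the separations efficiently distinguishing $X$ and $Y$ have order $k<\min(|X|,|Y|)$, then the set of all these separations is a $k$-bottleneck. (B3) For locally finite, connected $G$, the following construction of $N(G)$ is well-defined (all numbers $x^k(s)$ are finite), every $N^k(G,\beta)$ is non-empty, and $N(G)$ and all $N^{<k}(G)$ are $\mathrm{Aut}(G)$-invariant nested sets of tight separations. **Construction of $N(G)$ and $\mathcal T(G)$.** Let $\mathcal B^k(G)$ be the set of all $k$-bottlenecks in $G$ and $S^k=\bigcup\mathcal B^k(G)$. For $s\in S^k$ let $x^k(s)$ be the number of elements of $S^k$ that $s$ crosses. Recursively in $k\in\mathbb N$, let $N^{<k}(G)=\bigcup_{j<k}N^j(G)$; for $\beta\in\mathcal B^k(G)$ let $N^k(G,\beta)$ consist of those $s\in\beta$ that are nested with all of $N^{<k}(G)$ and among these have minimal $x^k(s)$; and let $N^k(G)=\bigcup_{\beta\in\mathcal B^k(G)}N^k(G,\beta)$. Set $N(G)=\bigcup_{k}N^k(G)$ and $\mathcal T(G):=\mathcal T(N(G))$. *)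

(* Defs.v *)
From mathcomp Require Import all_boot.
From mathcomp Require Import mathcomp_extra boolp classical_sets functions cardinality.
From Stdlib Require Import Relation_Operators.

Set Implicit Arguments.
Unset Strict Implicit.
Unset Printing Implicit Defensive.

Local Open Scope classical_set_scope.
Local Open Scope card_scope.

Record sgraph := SGraph {
  vertex :> Type;
  adj : vertex -> vertex -> Prop;
  adj_sym : forall x y, adj x y -> adj y x;
  adj_irr : forall x, ~ adj x x }.

Definition neighbours (G : sgraph) (v : G) : set G := [set u | adj v u].

Definition locally_finite (G : sgraph) : Prop :=
  forall v : G, finite_set (neighbours v).

(** [linked U x y]: there is a walk from [x] to [y] in [G[U]]. The trivial walk
    is allowed even when [x] is outside [U]; all uses below assume [U x]. *)
Definition linked (G : sgraph) (U : set G) : G -> G -> Prop :=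
  clos_refl_trans G (fun x y => [/\ U x, U y & adj x y]).

(** Connected graphs are non-empty. *)
Definition connected_set (G : sgraph) (U : set G) : Prop :=
  U !=set0 /\ forall x y, U x -> U y -> linked U x y.

Definition connected (G : sgraph) : Prop := connected_set [set: G].

Definition component (G : sgraph) (U C : set G) : Prop :=
  exists2 x, U x & C = [set y | linked U x y].

Definition boundary (G : sgraph) (C : set G) : set G :=
  [set v | ~ C v /\ exists2 u, C u & adj u v].

(** [ordS] is the cyclic successor on ['I_n]. *)
Definition is_cycle (G : sgraph) (n : nat) (c : 'I_n -> G) : Prop :=
  [/\ 3 <= n, injective c & forall i, adj (c i) (c (ordS i))].

Definition has_chord (G : sgraph) (n : nat) (c : 'I_n -> G) : Prop :=
  exists i j, [/\ j <> ordS i, i <> ordS j & adj (c i) (c j)].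

Definition chordal (G : sgraph) : Prop :=
  forall n (c : 'I_n -> G), 4 <= n -> is_cycle c -> has_chord c.

Definition is_tree (G : sgraph) : Prop :=
  connected G /\ forall n (c : 'I_n -> G), ~ is_cycle c.

Definition clique (G : sgraph) (X : set G) : Prop :=
  forall x y, X x -> X y -> x <> y -> adj x y.

Definition maximal_clique (G : sgraph) (X : set G) : Prop :=
  clique X /\ forall Y, clique Y -> X `<=` Y -> Y = X.

Definition automorphism (G : sgraph) (phi : G -> G) : Prop :=
  bijective phi /\ forall x y, adj (phi x) (phi y) <-> adj x y.

(** The unordered pair {A,B} is encoded as the set [[set A; B]] of its sides, and
    an orientation as an ordered pair of sets. *)
Notation usep V := (set (set V)) (only parsing).
Notation orsep V := (set V * set V)%type (only parsing).

Definition unorient (V : Type) (p : orsep V) : usep V := [set p.1; p.2].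

Definition is_oriented_separation (G : sgraph) (p : orsep G) : Prop :=
  p.1 `|` p.2 = setT /\
  forall x y, (p.1 `\` p.2) x -> (p.2 `\` p.1) y -> ~ adj x y.

Definition is_separation (G : sgraph) (s : usep G) : Prop :=
  exists2 p, s = unorient p & is_oriented_separation p.

Definition separator (V : Type) (s : usep V) : set V := \bigcap_(A in s) A.

Definition is_k_separation (G : sgraph) (k : nat) (s : usep G) : Prop :=
  is_separation s /\ separator s #= `I_k.

Definition tight (G : sgraph) (s : usep G) : Prop :=
  is_separation s /\
  forall A B, s = [set A; B] ->
    exists C, [/\ component (~` (A `&` B)) C, C `<=` A `\` B
                & boundary C = A `&` B].

Definition sep_le (V : Type) (p q : orsep V) : Prop :=
  p.1 `<=` q.1 /\ q.2 `<=` p.2.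

Definition nested (V : Type) (s s' : usep V) : Prop :=
  exists p q, [/\ s = unorient p, s' = unorient q & sep_le p q \/ sep_le q p].

Definition crosses (V : Type) (s s' : usep V) : Prop := ~ nested s s'.

Definition nested_set (V : Type) (N : set (usep V)) : Prop :=
  forall s s', N s -> N s' -> nested s s'.

Definition sep_image (V : Type) (phi : V -> V) (s : usep V) : usep V :=
  [set phi @` A | A in s].

Definition aut_invariant (G : sgraph) (N : set (usep G)) : Prop :=
  forall (phi : G -> G) s, automorphism phi -> N s -> N (sep_image phi s).

Definition distinguishes (V : Type) (s : usep V) (X Y : set V) : Prop :=
  exists A B, [/\ s = [set A; B], X `<=` A & Y `<=` B].

Definition efficiently_distinguishes (G : sgraph) (s : usep G) (X Y : set G) :
    Prop :=
  [/\ is_separation s, distinguishes s X Y &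
      forall s', is_separation s' -> distinguishes s' X Y ->
        separator s #<= separator s'].

Definition tree_decomposition (G T : sgraph) (bag : T -> set G) : Prop :=
  [/\ is_tree T,
      forall v, exists t, bag t v,
      forall u v, adj u v -> exists t, bag t u /\ bag t v
    & forall v, connected_set [set t | bag t v]].

(** An action of Aut(G) on the tree T, by automorphisms of T; the values of [act]
    outside Aut(G) are irrelevant. *)
Definition canonical_decomposition (G T : sgraph) (bag : T -> set G) : Prop :=
  exists act : (G -> G) -> T -> T,
    [/\ forall phi, automorphism phi -> automorphism (act phi),
        forall t, act idfun t = t,
        forall phi psi, automorphism phi -> automorphism psi ->
          forall t, act (phi \o psi) t = act phi (act psi t)
      & forall phi, automorphism phi ->
          forall t, bag (act phi t) = phi @` bag t].

Definition into_cliques (G T : sgraph) (bag : T -> set G) : Prop :=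
  forall t, clique (bag t).

Definition is_orientation (V : Type) (N : set (usep V)) (O : set (orsep V)) :
    Prop :=
  (forall p, O p -> N (unorient p)) /\
  (forall s, N s -> exists! p, O p /\ s = unorient p).

Definition consistent (V : Type) (O : set (orsep V)) : Prop :=
  forall p q, O p -> O q -> unorient p <> unorient q ->
    ~ sep_le (p.2, p.1) q.

Definition maximal_elements (V : Type) (O : set (orsep V)) : set (orsep V) :=
  [set p | O p /\ forall q, O q -> sep_le p q -> q = p].

Definition is_node (V : Type) (N : set (usep V)) (sigma : set (orsep V)) : Prop :=
  exists O, [/\ is_orientation N O, consistent O,
    forall p, O p -> exists2 q, maximal_elements O q & sep_le p q
    & sigma = maximal_elements O].

Definition node (V : Type) (N : set (usep V)) : Type := {sigma | is_node N sigma}.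

(** Distinctness of the ends is automatic when [N] consists of proper separations;
    it is required so that the graph is simple for every [N]. *)
Definition node_adj (V : Type) (N : set (usep V)) (t u : node N) : Prop :=
  t <> u /\
  exists A B, [/\ N [set A; B], sval t (A, B) & sval u (B, A)].

Lemma node_adj_sym (V : Type) (N : set (usep V)) (t u : node N) :
  node_adj t u -> node_adj u t.
Proof.
move=> [tu [A [B [NAB tAB uBA]]]]; split; first exact/nesym.
by exists B, A; rewrite setUC.
Qed.

Lemma node_adj_irr (V : Type) (N : set (usep V)) (t : node N) : ~ node_adj t t.
Proof. by case. Qed.

Definition sep_tree (V : Type) (N : set (usep V)) : sgraph :=
  SGraph (@node_adj_sym V N) (@node_adj_irr V N).

Definition sep_bag (V : Type) (N : set (usep V)) (t : sep_tree N) : set V :=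
  \bigcap_(p in sval t) p.2.

(** The cardinality of a finite set; 0 for infinite sets. *)
Definition ncard (T : Type) (A : set T) : nat := xget 0 [set n | A #= `I_n].

(** From here to [N_all], which is N(G), [B k] is the set of all k-bottlenecks of
    a fixed graph G. *)
Definition bottleneck_seps (V : Type) (B : nat -> set (set (usep V))) (k : nat) :
    set (usep V) :=
  \bigcup_(beta in B k) beta.

Definition crossed_by (V : Type) (B : nat -> set (set (usep V))) (k : nat)
    (s : usep V) : set (usep V) :=
  [set s' | bottleneck_seps B k s' /\ crosses s s'].

Definition crossing_number (V : Type) (B : nat -> set (set (usep V))) (k : nat)
    (s : usep V) : nat :=
  ncard (crossed_by B k s).

Definition nested_with_all (V : Type) (prev : set (usep V)) (s : usep V) : Prop :=
  forall s', prev s' -> nested s s'.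

(** N^k(G,beta), where [prev] stands for N^{<k}(G) *)
Definition select (V : Type) (B : nat -> set (set (usep V))) (k : nat)
    (prev beta : set (usep V)) : set (usep V) :=
  [set s | [/\ beta s, nested_with_all prev s &
    forall s', beta s' -> nested_with_all prev s' ->
      crossing_number B k s <= crossing_number B k s']].

(** N^{<k}(G); N^{<k+1}(G) is the union of N^{<k}(G) and N^k(G). *)
Fixpoint N_below (V : Type) (B : nat -> set (set (usep V))) (k : nat) :
    set (usep V) :=
  if k is j.+1 then
    N_below B j `|` \bigcup_(beta in B j) select B j (N_below B j) beta
  else set0.

Definition N_at_beta (V : Type) (B : nat -> set (set (usep V))) (k : nat)
    (beta : set (usep V)) : set (usep V) :=
  select B k (N_below B k) beta.

Definition N_at (V : Type) (B : nat -> set (set (usep V))) (k : nat) :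
    set (usep V) :=
  \bigcup_(beta in B k) N_at_beta B k beta.

Definition N_all (V : Type) (B : nat -> set (set (usep V))) : set (usep V) :=
  \bigcup_k N_at B k.

(** The bottlenecks of Jacobs, Knappe and Kurkofka are treated as an arbitrary
    notion with the properties below: [bn G k] is the set of all k-bottlenecks
    of [G]. *)
Record bottleneck_notion (bn : forall G : sgraph, nat -> set (set (usep G))) :
    Prop := {
  bn_nonempty : forall (G : sgraph) k beta, bn G k beta -> beta !=set0;
  bn_k_separation : forall (G : sgraph) k beta s,
    bn G k beta -> beta s -> is_k_separation k s;
  bn_automorphism : forall (G : sgraph) k beta (phi : G -> G),
    automorphism phi -> bn G k beta -> bn G k [set sep_image phi s | s in beta];
  bn_cliques : forall (G : sgraph) k (X Y : set G),
    locally_finite G -> chordal G ->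
    maximal_clique X -> maximal_clique Y -> X <> Y ->
    (forall s, efficiently_distinguishes s X Y -> separator s #= `I_k) ->
    ~~ (X #<= `I_k) -> ~~ (Y #<= `I_k) ->
    bn G k [set s | efficiently_distinguishes s X Y];
  bn_crossing_finite : forall (G : sgraph) k s,
    locally_finite G -> connected G ->
    bottleneck_seps (bn G) k s -> finite_set (crossed_by (bn G) k s);
  bn_select_nonempty : forall (G : sgraph) k beta,
    locally_finite G -> connected G ->
    bn G k beta -> N_at_beta (bn G) k beta !=set0;
  bn_N_below : forall (G : sgraph) k, locally_finite G -> connected G ->
    [/\ aut_invariant (N_below (bn G) k), nested_set (N_below (bn G) k)
      & forall s, N_below (bn G) k s -> tight s];
  bn_N_all : forall G : sgraph, locally_finite G -> connected G ->
    [/\ aut_invariant (N_all (bn G)), nested_set (N_all (bn G))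
      & forall s, N_all (bn G) s -> tight s] }.

(* Main.v *)
(** A tight separation of a chordal graph has a clique as separator, so in the
    locally finite case [N_all] is point-finite and [sep_tree] is a tree
    decomposition. Suppose that a bag W contains non-adjacent vertices x and y.
    Take cliques Zx, Zy maximal in W with x in Zx and y in Zy, and extend them to
    maximal cliques X, Y of G. Some s in [N_all] distinguishes X and Y efficiently;
    say W lies on the side of Y. Then Zx lies in the separator of s, and also in
    the separator of a separation at the node of W, so these two cliques of W agree
    by maximality. Let K be the component of G - Zx containing y. If every vertex of
    Zx had a neighbour in K, chordality would yield a vertex of K complete to Zx; it
    would lie outside of W by maximality of Zx, hence behind a separation at this
    node with separator Zx, which would separate it from y. So the boundary of K is
    a proper subset of Zx that separates X from Y, contradicting efficiency. *)
Require Import Defs.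
From mathcomp Require Import all_boot finmap.
From mathcomp Require Import mathcomp_extra boolp classical_sets functions cardinality.
From mathcomp Require Import zify.
From Stdlib Require Import Relation_Operators Operators_Properties.

Set Implicit Arguments.
Unset Strict Implicit.
Unset Printing Implicit Defensive.

Local Open Scope classical_set_scope.
Local Open Scope card_scope.

(** * Finite sets *)

Lemma finite_proper_ind (T : Type) (P : set T -> Prop) :
  (forall A, finite_set A -> (forall B, B `<` A -> P B) -> P A) ->
  forall A, finite_set A -> P A.
Proof.
move=> IH A; change (set {classic T}) in (type of A).
have [n] := ubnP (#|` fset_set A|); elim: n A => // n IHn A.
rewrite ltnS => An Af; apply: (IH _ Af) => B [BA AB].
have Bf : finite_set (B : set {classic T}) by exact: sub_finite_set BA Af.
apply: IHn => //; apply: leq_trans An; apply: fproper_ltn_card.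
rewrite fproperEneq; apply/andP; split.
  by apply/eqP => /(fset_set_inj Bf Af) E; apply: AB; rewrite E.
by rewrite -(fset_set_sub Bf Af).
Qed.

Lemma finite_proper_card (T : Type) (A B : set T) :
  A `<` B -> finite_set B -> ~ (B #<= A).
Proof.
move=> [AB nBA] Bf BA; apply: nBA => x Bx.
have Af := sub_finite_set AB Bf.
change (set {classic T}) in (type of A).
change (set {classic T}) in (type of B).
have [m Am] : exists m, A #= `I_m by apply/finite_setP.
have [n Bn] : exists n, B #= `I_n by apply/finite_setP.
have nm : (n <= m)%N by rewrite -card_le_II -(card_le_eqr Am) -(card_le_eql Bn).
have sAB : (fset_set A `<=` fset_set B)%fset by rewrite -(@fset_set_sub {classic T} A B Af Bf).
have eAB : fset_set A = fset_set B.
  apply/eqP; rewrite eqEfcard sAB /= (card_fset_set Am).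
  by rewrite (card_fset_set Bn).
by rewrite (@fset_set_inj {classic T} A B Af Bf eAB).
Qed.

(** An element of [D] is determined by two subsets of [M], the traces of its images under [f] and
    [g], and a finite set has only finitely many subsets. *)
Lemma finite_traces (T V : Type) (D : set T) (M : set V) (f g : T -> set V) :
  finite_set M -> 
  (forall p q, D p -> D q -> f p `&` M = f q `&` M -> g p `&` M = g q `&` M ->
    p = q) ->
  finite_set D.
Proof.
move=> Mf inj; change (set {classic V}) in (type of M).
have pf : finite_set [set A : set V | A `<=` M].
  have := finite_fset (fpowerset (fset_set M)).
  move=> /(finite_image (fun X : {fset {classic V}} => [set` X] : set V)).
  apply: sub_finite_set => A AM; have Af := sub_finite_set AM Mf.
  exists (fset_set (A : set {classic V})); last exact: (@fset_setK {classic V} A Af).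
  by rewrite /= fpowersetE -(@fset_set_sub {classic V} A M Af Mf).
pose h p := (f p `&` M, g p `&` M).
have hi : {in D &, injective h}.
  move=> p q; rewrite !inE => Dp Dq [e1 e2]; exact: inj.
apply: card_le_finite (finite_setX pf pf).
rewrite -(card_le_eql (inj_card_eq hi)); apply: subset_card_le => _ [p _ <-].
by split=> x [].
Qed.

Lemma finite_list (T : Type) (A : set T) :
  finite_set A -> exists s : list T, forall x, A x <-> List.In x s.
Proof.
move=> /(@finite_seqP {classic T} A)[s ->]; exists s => x /=.
elim: s => //= y s IH; rewrite inE; split.
- by case/orP => [/eqP ->|/IH]; [left|right].
- by case=> [->|/IH ->]; rewrite ?eqxx ?orbT.
Qed.

Lemma finite_maximal (T : Type) (le : T -> T -> Prop) (A : set T) (x : T) :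
  (forall a b c, le a b -> le b c -> le a c) ->
  (forall a b, le a b -> le b a -> a = b) ->
  (forall a, le a a) ->
  finite_set A -> A x ->
  exists m, [/\ A m, le x m & forall y, A y -> le m y -> y = m].
Proof.
move=> tr as_ rf Af; move: A Af x; apply: finite_proper_ind => A Af IH x Ax.
case: (pselect (forall y, A y -> le x y -> y = x)) => [mx|].
  by exists x.
move=> /existsNP[y] /not_implyP[Ay] /not_implyP[xy nyx].
(* As [x] is not maximal, continue among the elements above the larger [y]; this set is strictly
   smaller because it misses [x]. *)
have [|m [Bm ym mm]] := IH [set z | A z /\ le y z] _ y (conj Ay (rf y)).
  split=> [z []//|/(_ x Ax)[_ yx]]; exact/nyx/as_.
exists m; split; first by case: Bm.
- exact: tr ym.
- by move=> z Az mz; apply: mm => //; split=> //; exact: tr mz.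
Qed.

Lemma set2_eq (V : Type) (A B C D : set V) :
  [set A; B] = [set C; D] -> (A = C /\ B = D) \/ (A = D /\ B = C).
Proof.
move=> E.
have hA : [set C; D] A by rewrite -E; left.
have hB : [set C; D] B by rewrite -E; right.
have hC : [set A; B] C by rewrite E; left.
have hD : [set A; B] D by rewrite E; right.
move: hA hB hC hD => /= [->|->] [->|->] [?|?] [?|?]; subst; by [left|right].
Qed.

(** * Walks, induced paths and holes *)

Definition flip (V : Type) (p : set V * set V) : set V * set V := (p.2, p.1).

Lemma unorient_flip (V : Type) (p : set V * set V) :
  unorient (flip p) = unorient p.
Proof. by rewrite /unorient setUC. Qed.

Lemma flipK (V : Type) : involutive (@flip V).
Proof. by case. Qed.

Lemma unorient_eq (V : Type) (p q : set V * set V) :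
  unorient p = unorient q -> p = q \/ p = flip q.
Proof.
case: p q => [A B] [C D] /set2_eq [[/= -> ->]|[/= -> ->]]; by [left|right].
Qed.

Lemma separator_unorient (V : Type) (p : set V * set V) :
  separator (unorient p) = p.1 `&` p.2.
Proof. by rewrite /separator /unorient bigcap_setU !bigcap_set1. Qed.

Section Graph.
Variable G : sgraph.
Implicit Types (U C K X Y : set G) (p : set G * set G).

Lemma linked_sym U x y : linked U x y -> linked U y x.
Proof.
elim=> [u v [Uu Uv uv]|u|u v w _ IH1 _ IH2].
- by apply: rt_step; split=> //; exact: adj_sym.
- exact: rt_refl.
- exact: rt_trans IH2 IH1.
Qed.

Lemma linked_in U x y : linked U x y -> U x -> U y.
Proof. by elim=> [u v []//|//|u v w _ IH1 _ IH2 /IH1]. Qed.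

Lemma linked_sub U U' x y : U `<=` U' -> linked U x y -> linked U' x y.
Proof.
move=> UU'; elim=> [u v [Uu Uv uv]|u|u v w _ IH1 _ IH2].
- by apply: rt_step; split=> //; exact: UU'.
- exact: rt_refl.
- exact: rt_trans IH1 IH2.
Qed.

Lemma separation_flip p :
  is_oriented_separation p -> is_oriented_separation (flip p).
Proof.
case=> E H; split=> [|x y hx hy]; first by rewrite setUC.
by move=> /adj_sym; exact: H.
Qed.

Lemma separation_cover p x : is_oriented_separation p -> p.1 x \/ p.2 x.
Proof. by case=> E _; have : (p.1 `|` p.2) x by rewrite E. Qed.

Lemma separation_step p x y : is_oriented_separation p -> adj x y ->
  p.1 x -> ~ p.2 x -> p.1 y.
Proof.
move=> Hp xy px nx; case: (separation_cover y Hp) => // py.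
by apply: contrapT => ny; case: Hp => _ /(_ x y); apply.
Qed.

(** No edge joins the two strict sides, so the walk has to pass through the separator. Keeping [U]
    makes this applicable to walks that avoid a given clique. *)
Lemma separation_link p U x y : is_oriented_separation p ->
  linked U x y -> U x -> p.1 x -> p.2 y -> exists z, [/\ U z, p.1 z & p.2 z].
Proof.
move=> Hp; elim=> [u v [Uu Uv uv]|u|u v w uv IH1 _ IH2] Ux px py.
- have [pu|nu] := pselect (p.2 u); first by exists u.
  by exists v; split=> //; exact: separation_step uv _ nu.
- by exists u.
- case: (separation_cover v Hp) => pv; last exact: IH1.
  by apply: IH2 => //; exact: linked_in Ux.
Qed.

Lemma connected_linked U x : U x -> connected_set [set y | linked U x y].
Proof.
move=> Ux; have H y : linked U x y -> linked [set y | linked U x y] x y.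
  move=> /clos_rt_rtn1_iff xy; elim: xy => [|u v uv xu IH]; first exact: rt_refl.
  apply: rt_trans IH _; apply: rt_step; case: uv => Uu Uv uv.
  move/clos_rt_rtn1_iff in xu; split=> //=; apply: rt_trans xu _.
  exact: rt_step.
split; first by exists x; exact: rt_refl.
move=> u v xu xv; apply: rt_trans (H _ xv); exact/linked_sym/H.
Qed.

(** The length [l] counts edges, and values of [q] beyond [l] are irrelevant. Consecutive vertices
    are distinct because adjacency is irreflexive. *)
Definition induced_path (l : nat) (q : nat -> G) :=
  (forall i, i < l -> adj (q i) (q i.+1)) /\
  (forall i j, i.+1 < j <= l -> q i <> q j /\ ~ adj (q i) (q j)).

Lemma induced_path_inj l q i j : induced_path l q ->
  i <= l -> j <= l -> q i = q j -> i = j.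
Proof.
move=> [q1 q2].
have W a b : a < b <= l -> q a <> q b.
  case/andP=> ab bl; case: (ltngtP a.+1 b) => [h|h|E]; last 1 first.
  - subst b => E; have := q1 a bl; rewrite E; exact: adj_irr.
  - by case: (q2 a b) => //; rewrite h.
  - by lia.
move=> il jl E; case: (ltngtP i j) => // h.
  by case: (W i j); rewrite ?h.
by case: (W j i); rewrite ?h.
Qed.

(** A shortest walk is an induced path, since a repeated vertex or a chord would allow a
    shortcut. *)
Lemma linked_induced_path U x y : linked U x y -> U x ->
  exists l q, [/\ q 0 = x, q l = y, forall i, i <= l -> U (q i)
    & induced_path l q].
Proof.
move=> xy Ux.
pose W v n := exists q : nat -> G, [/\ q 0 = x, q n = v,
  forall i, i <= n -> U (q i) & forall i, i < n -> adj (q i) (q i.+1)].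
have exW : exists n, `[< W y n >].
  move/clos_rt_rtn1_iff: xy; elim=> [|u v [Uu Uv uv] _ [n /asboolP[q [q0 qn qU qs]]]].
    by exists 0; apply/asboolP; exists (fun=> x); split=> //.
  exists n.+1; apply/asboolP; exists (fun i => if i <= n then q i else v).
  split=> [//||i|i]; first by rewrite ltnn.
    by case: ifP => // ? _; exact: qU.
  rewrite ltnS => il; rewrite il; case: ifP => h; first exact: qs.
  have -> : i = n by lia.
  by rewrite qn.
have [l /asboolP[q [q0 ql qU qs]] lmin] := ex_minnP exW.
exists l, q; split=> //; split=> // i j /andP[ij jl].
split.
  (* If [q i = q j], cut out the [j - i] steps between them. *)
  move=> E; suff /lmin : `[< W y (l - (j - i)) >] by lia.
  apply/asboolP; exists (fun k => if k <= i then q k else q (k + (j - i))); split.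
  - by [].
  - case: ifP => h; last by rewrite subnK //; lia.
    have -> : l - (j - i) = i by lia.
    by rewrite E -ql; congr q; lia.
  - by move=> k kl; case: ifP => h; apply: qU; lia.
  - move=> k kl; case: ifP => h; case: ifP => h'; try lia.
    + by apply: qs; lia.
    + have -> : k = i by lia.
      have -> : i.+1 + (j - i) = j.+1 by lia.
      by rewrite E; apply: qs; lia.
    + by rewrite addSn; apply: qs; lia.
(* If [q i] and [q j] are adjacent, go directly from one to the other, which saves [j - i.+1]
   steps. *)
move=> E; suff /lmin : `[< W y (l - (j - i.+1)) >] by lia.
apply/asboolP; exists (fun k => if k <= i then q k else q (k + (j - i.+1))); split.
- by [].
- case: ifP => h; first by lia.
  by rewrite subnK //; lia.
- by move=> k kl; case: ifP => h; apply: qU; lia.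
- move=> k kl; case: ifP => h; case: ifP => h'; try lia.
  + by apply: qs; lia.
  + have -> : k = i by lia.
    by have -> : i.+1 + (j - i.+1) = j by lia.
  + by rewrite addSn; apply: qs; lia.
Qed.

Lemma val_ordS n (i : 'I_n) : 
  ordS i = (if i.+1 < n then i.+1 else 0) :> nat.
Proof.
rewrite /=; case: ifP => h; first by rewrite modn_small.
have -> : i.+1 = n by have := ltn_ord i; lia.
exact: modnn.
Qed.

(** The two paths share their ends and have no contact between their interiors, so their union is a
    chordless cycle of length [l + m], which is at least 4. *)
Lemma chordal_no_hole l m (q r : nat -> G) : chordal G ->
  1 < l -> 1 < m -> induced_path l q -> induced_path m r ->
  q 0 = r m -> q l = r 0 ->
  (forall i j, 0 < i < l -> 0 < j < m -> q i <> r j /\ ~ adj (q i) (r j)) ->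
  False.
Proof.
move=> chG l1 m1 [q1 q2] [r1 r2] e0 el qr.
have qI := induced_path_inj (conj q1 q2).
have rI := induced_path_inj (conj r1 r2).
(* The cycle runs through [q 0, ..., q l] and then [r 1, ..., r m.-1]; the vertices [r 0] and [r m]
   are already present as [q l] and [q 0]. *)
pose d k := if k <= l then q k else r (k - l).
(* The pair of [0] and [(l + m).-1] is excluded since it is the edge closing the cycle. *)
have far i j : i < j < l + m -> j <> i.+1 -> ~ (i = 0 /\ j = (l + m).-1) ->
    d i <> d j /\ ~ adj (d i) (d j).
  move=> /andP[ij jn] ji h; rewrite /d; case: ifP => hi; case: ifP => hj.
  - by apply: q2; lia.
  - case: (eqVneq i 0) => [i0|i0].
      rewrite i0 e0; case: (r2 (j - l) m); first by lia.
      by move=> ? na; split; [exact: nesym|move=> /adj_sym].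
    case: (eqVneq i l) => [il|il]; first by rewrite il el; apply: r2; lia.
    by apply: qr; lia.
  - lia.
  - by apply: r2; lia.
have dneq i j : i < j < l + m -> d i <> d j.
  move=> ijn; case: (pselect (j = i.+1 \/ (i = 0 /\ j = (l + m).-1))).
    case/andP: ijn => ij jn; rewrite /d => -[h|[h1 h2]].
      case: ifP => hi; case: ifP => hj.
      + by move=> /qI; lia.
      + have -> : i = l by lia.
        by rewrite el => /rI; lia.
      + lia.
      + by move=> /rI; lia.
    by case: ifP => hi; case: ifP => hj; try lia; rewrite h1 e0 => /rI; lia.
  by move=> /not_orP[h1 h2]; case: (far i j).
pose c (i : 'I_(l + m)) := d i.
have cinj : injective c.
  move=> i j E; apply: val_inj => /=; case: (ltngtP i j) => // h.
  - by case: (dneq i j); rewrite ?h ?ltn_ord.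
  - by case: (dneq j i); rewrite ?h ?ltn_ord.
have cyc : is_cycle c.
  split=> //; first by lia.
  move=> i; rewrite /c val_ordS; have := ltn_ord i.
  move: (nat_of_ord i) => {}i ilt; rewrite /d.
  case: (boolP (i.+1 < l + m)) => hj /=; case: (boolP (i <= l)) => hi; rewrite ?leq0n;
    try case: ifP => hS; try lia.
    by apply: q1; lia.
  - have -> : i = l by lia.
    have -> : l.+1 - l = 1 by lia.
    by rewrite el; apply: r1; lia.
  - by rewrite subSn; [apply: r1; lia|lia].
  - rewrite e0; have -> : m = (i - l).+1 by lia.
    by apply: r1; lia.
have [|i [j [h1 h2 h3]]] := chG _ c _ cyc; first by lia.
have key (a b : 'I_(l + m)) : a < b -> b <> ordS a -> a <> ordS b ->
    ~ adj (c a) (c b).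
  move=> ab ha hb; have bn := ltn_ord b.
  case: (far a b) => //; first by rewrite ab.
  - by move=> E; apply: ha; apply: val_inj; apply: etrans (esym (val_ordS a)); rewrite -E bn.
  - move=> [E1 E2]; apply: hb; apply: val_inj; apply: etrans (esym (val_ordS b)).
    by rewrite /= E1 E2; case: ifP => //; lia.
case: (ltngtP i j) => h.
- exact: (key i j).
- by apply: (key j i) => //; exact: adj_sym.
- by move: h3; rewrite (val_inj h); exact: adj_irr.
Qed.

End Graph.

(** * Chordal graphs *)

Section Chordal.
Variable G : sgraph.
Implicit Types (U C K X Y : set G) (p : set G * set G).

(** Take an induced path from [x] to [y] in [C] together with [x] and [y]. It meets [x] and [y] only
    at its ends, and it has an inner vertex because they are distinct and non-adjacent. *)
Lemma path_through C x y : connected_set C -> boundary C x -> boundary C y ->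
  x <> y -> ~ adj x y ->
  exists l q, [/\ 1 < l, induced_path l q, q 0 = x, q l = y
    & forall i, 0 < i < l -> C (q i)].
Proof.
move=> [_ Cc] [nx [u Cu ux]] [ny [v Cv vy]] xy nxy.
have CU : C `<=` C `|` [set x; y] by left.
have Ux : (C `|` [set x; y]) x by right; left.
have Uy : (C `|` [set x; y]) y by right; right.
have xLy : linked (C `|` [set x; y]) x y.
  apply: (@rt_trans _ _ _ u).
    by apply: rt_step; split=> //; [exact: CU|exact: adj_sym].
  apply: (@rt_trans _ _ _ v); first exact/(linked_sub CU)/Cc.
  by apply: rt_step; split=> //; exact: CU.
have [l [q [q0 ql qU qi]]] := linked_induced_path xLy Ux.
have l1 : 1 < l.
  case: l => [|[|l]] // in ql qi qU *; first by case: xy; rewrite -q0 -ql.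
  by case: nxy; rewrite -q0 -ql; case: qi => + _; apply.
exists l, q; split=> // i il; case: (qU i); first by lia.
  by [].
by case=> E; move: E; rewrite /= -?q0 -?ql => /(induced_path_inj qi); lia.
Qed.

(** Two non-adjacent vertices of the separator would be joined by induced paths through the tight
    components on either side, and these two paths would form a hole. *)
Lemma chordal_tight_clique (s : set (set G)) A B : chordal G -> tight s ->
  s = [set A; B] -> clique (A `&` B).
Proof.
move=> chG [_ tS] sE x y Xx Xy xy; apply: contrapT => nxy.
have [C [[c Uc CE] CA bC]] := tS _ _ sE.
have [C' [[c' Uc' C'E] CB bC']] := tS B A (etrans sE (setUC _ _)).
have Cc : connected_set C by rewrite CE; exact: connected_linked.
have C'c : connected_set C' by rewrite C'E; exact: connected_linked.
rewrite setIC in bC'.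
have [l [q [l1 qi q0 ql qC]]] := path_through Cc
  (eq_ind_r (fun Z => Z x) Xx bC) (eq_ind_r (fun Z => Z y) Xy bC) xy nxy.
have nyx : ~ adj y x by move/adj_sym.
have [m [r [m1 ri r0 rm rC]]] := path_through C'c
  (eq_ind_r (fun Z => Z y) Xy bC') (eq_ind_r (fun Z => Z x) Xx bC') (nesym xy) nyx.
apply: (chordal_no_hole chG l1 m1 qi ri); rewrite ?q0 ?ql ?rm ?r0 //.
move=> i j /qC Ci /rC Cj; have [Ai nBi] := CA _ Ci; have [Bj nAj] := CB _ Cj.
split=> [E|qr]; first by apply: nAj; rewrite -E.
(* A neighbour of [C] outside [C] lies in the separator, whereas [r j] is strictly on the other
   side. *)
have : boundary C (r j) by split; [move/CA => -[]|exists (q i)].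
by rewrite bC => -[].
Qed.

(* Walk from a vertex complete to a part of [K] towards a neighbour of the next
   vertex [z] along an induced path: by chordality its last vertex before [z]
   is still complete to that part. *)
Lemma chordal_complete C K : chordal G -> connected_set C -> finite_set K ->
  clique K -> K `<=` boundary C -> exists2 c, C c & forall w, K w -> adj c w.
Proof.
move=> chG Cc /finite_list[s sK] cK bK.
have : exists2 c, C c & forall w, K w -> List.In w s -> adj c w; last first.
  by case=> c Cc' cs; exists c => // w Kw; apply: cs => //; apply/sK.
elim: s {sK} => [|z s [c Cc' cs]]; first by case: Cc => -[c Cc' _]; exists c.
have [Kz|nKz] := pselect (K z); last first.
  by exists c => // w Kw [zw|]; [case: nKz; rewrite zw|exact: cs].
have [nCz [u Cu uz]] := bK z Kz.
have cLz : linked (C `|` [set z]) c z.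
  apply: (@rt_trans _ _ _ u); last by apply: rt_step; split=> //; [left|right].
  by apply: (@linked_sub _ C); [left|case: Cc => _; apply].
have [l [q [q0 ql qU qi]]] := linked_induced_path cLz (or_introl Cc').
have l0 : 0 < l by case: l => // in ql qi qU *; case: nCz; rewrite -ql q0.
have qC i : i < l -> C (q i).
  move=> il; case: (qU i) => //; first by lia.
  by rewrite /= -ql => /(induced_path_inj qi); lia.
have ql1 : adj (q l.-1) z by rewrite -ql -{2}(prednK l0); case: qi => + _; apply; lia.
exists (q l.-1) => [|w Kw]; first by apply: qC; lia.
case=> [<- //|ws]; have [-> //|wz] := pselect (w = z).
have aw : exists i, (i < l) && `[< adj (q i) w >].
  by exists 0; rewrite l0 q0; apply/asboolP/cs.
have ub i : (i < l) && `[< adj (q i) w >] -> i <= l by case/andP; lia.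
(* The last vertex of the path before [z] that is adjacent to [w]; [q 0 = c] is a candidate. *)
have [i /andP[il /asboolP iw] imax] := ex_maxnP aw ub.
case: (eqVneq i l.-1) => [<- //|nil].
have nCw := (bK w Kw).1.
(* The path [z, w, q i] closes the segment of [q] from [q i] to [z] to a hole. *)
exfalso; pose r k := if k is k'.+1 then if k' is 0 then w else q i else z.
have q'i : induced_path (l - i) (fun k => q (i + k)).
  case: qi => q1 q2; split=> [k kl|j k jk]; first by rewrite addnS; apply: q1; lia.
  by apply: q2; lia.
have l'1 : 1 < l - i by lia.
apply: (chordal_no_hole chG l'1 (isT : 1 < 2) q'i (r := r)) => //=.
- split=> [[|[|//]] _|[|[|j]] [|[|[|k]]] //] /=.
  + exact/adj_sym/cK.
  + exact: adj_sym.
  + move=> _; rewrite -ql; case: (qi) => _ /(_ i l) [|h1 h2]; first by lia.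
    by split; [exact/nesym|move/adj_sym].
  + by lia.
- by rewrite addn0.
- by rewrite subnKC //; lia.
move=> k [|[|//]] kl // _ /=; split.
  by move=> E; apply: nCw; rewrite -E; apply: qC; lia.
move=> h; have := imax (i + k); case: ltnP => //=; last by lia.
by move=> _; move/asboolP: h => -> /(_ isT); lia.
Qed.

(** * Cliques and clique separators in locally finite graphs *)

Lemma finite_clique X : locally_finite G -> clique X -> finite_set X.
Proof.
move=> lf cX; have [->|/set0P[x Xx]] := eqVneq X set0; first exact: finite_set0.
have fx : finite_set (x |` neighbours x) by rewrite finite_setU; split.
apply: sub_finite_set fx => y Xy; have [->|yx] := pselect (y = x); first by left.
by right; apply: cX => //; exact: nesym.
Qed.

(* A separation [p] with clique separator containing [v] is determined by its
   trace on the ball of radius 2 around [v], since this ball contains the separator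
   and all its neighbours. *)
Lemma finite_clique_separations (D : set (set G * set G)) (v : G) :
  locally_finite G -> connected G ->
  (forall p, D p -> [/\ is_oriented_separation p, clique (p.1 `&` p.2),
    p.1 v & p.2 v]) -> finite_set D.
Proof.
move=> lf [_ cG] HD.
pose N1 := v |` neighbours v.
pose M := N1 `|` \bigcup_(u in N1) neighbours u.
have N1f : finite_set N1 by rewrite finite_setU; split.
have Mf : finite_set M by rewrite finite_setU; split=> //; apply: bigcup_finite.
have sepN1 p x : D p -> p.1 x -> p.2 x -> N1 x.
  move=> /HD[_ cl p1v p2v] p1 p2; have [->|xv] := pselect (x = v); first by left.
  by right; apply: cl => //; exact: nesym.
apply: (finite_traces (f := fst) (g := snd) Mf) => p q Dp Dq e1 e2.
have eM x : M x -> (p.1 x <-> q.1 x) /\ (p.2 x <-> q.2 x).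
  move=> Mx; split; split=> h.
  - by have [] : (q.1 `&` M) x by rewrite -e1.
  - by have [] : (p.1 `&` M) x by rewrite e1.
  - by have [] : (q.2 `&` M) x by rewrite -e2.
  - by have [] : (p.2 `&` M) x by rewrite e2.
have [Hp _ _ _] := HD _ Dp; have [Hq _ _ _] := HD _ Dq.
(* Agreement of [p] and [q] spreads along walks from [v]. A step from a vertex of the separator
   stays in [M]. A step from a vertex strictly on one side stays on that side for both, and the
   other side is decided by membership in the separator, which lies in [M]. *)
have eA x : (p.1 x <-> q.1 x) /\ (p.2 x <-> q.2 x).
  have /clos_rt_rtn1_iff := cG v x I I.
  elim=> [|y z [_ _ yz] _ IH]; first by apply: eM; left; left.
  have [py|npy] := pselect (p.1 y /\ p.2 y).
    by apply: eM; right; exists y => //; case: py; exact: sepN1.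
  have nqy : ~ (q.1 y /\ q.2 y) by case: IH => i1 i2 [/i1 ? /i2 ?]; apply: npy.
  have eS : (p.1 z /\ p.2 z) <-> (q.1 z /\ q.2 z).
    have W a b : D a -> D b -> a.1 z -> a.2 z -> (forall x, M x ->
      (a.1 x <-> b.1 x) /\ (a.2 x <-> b.2 x)) -> b.1 z /\ b.2 z.
      move=> Da Db a1 a2 /(_ z) [|h1 h2]; first by left; exact: sepN1 a1 a2.
      by split; [exact/h1|exact/h2].
    split=> -[h1 h2]; first exact: (W p q).
    by apply: (W q p) => // ? /eM [h h']; split; apply: iff_sym.
  have [p1y|np1y] := pselect (p.1 y).
    have np2 : ~ p.2 y by move=> ?; apply: npy.
    have p1z := separation_step Hp yz p1y np2.
    have q1y : q.1 y by apply IH.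
    have nq2 : ~ q.2 y by move=> ?; apply: nqy.
    have q1z := separation_step Hq yz q1y nq2.
    by split; [split|split=> h; apply eS].
  have p2y : p.2 y by case: (separation_cover y Hp).
  have p2z := separation_step (separation_flip Hp) yz p2y np1y.
  have nq1 : ~ q.1 y by move=> h; apply: np1y; apply IH.
  have q2y : q.2 y by case: (separation_cover y Hq).
  have q2z := separation_step (separation_flip Hq) yz q2y nq1.
  by split; split=> // h; apply eS.
case: p q eA {Dp Dq e1 e2 eM Hp Hq} => [A B] [A' B'] /= eA.
by congr (_, _); apply/seteqP; split=> x; apply eA.
Qed.

(** Cut off the component [K] of [G - X] that contains [y]; the separator is the boundary of [K]. If
    it were all of [X], chordality would yield a vertex of [K] complete to [X], which is excluded by
    hypothesis. *)
Lemma component_separation X Y y : locally_finite G -> chordal G -> clique X ->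
  clique Y -> Y y -> ~ X y ->
  (forall u, linked (~` X) y u -> ~ (forall w, X w -> adj u w)) ->
  exists p, [/\ is_oriented_separation p, Y `<=` p.2,
    p.1 `&` p.2 `<` X & forall z, ~ linked (~` X) y z -> p.1 z].
Proof.
move=> lf chG cX cY Yy nXy nc.
pose K := [set z | linked (~` X) y z].
have KX z : K z -> ~ X z by move=> /linked_in /(_ nXy).
have bK z : boundary K z -> X z.
  move=> [nKz [u Ku uz]]; apply: contrapT => nXz; apply: nKz.
  by apply: rt_trans (Ku) _; apply: rt_step; split=> //; exact: KX.
have Kc : connected_set K by exact: connected_linked.
exists (~` K, K `|` boundary K); split=> [| |/=|//].
- split=> [|u v [/= nKu nb] [_ /contrapT Kv] uv].
    by apply/seteqP; split=> // z _; have [?|?] := pselect (K z); [right; left|left].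
  by apply: nb; right; split=> //; exists v => //; exact: adj_sym.
- move=> z Yz; have [Kz|nKz] := pselect (K z); first by left.
  right; split=> //; exists y; first exact: rt_refl.
  by apply: cY => // yz; apply: nKz; rewrite -yz; exact: rt_refl.
split=> [z [nKz [//|]]|]; first exact: bK.
move=> XK; have Xb z : X z -> boundary K z by move=> /XK[nK [/nK|]].
have [u Ku uX] := chordal_complete chG Kc (finite_clique lf cX) cX Xb.
exact: nc Ku uX.
Qed.

Lemma maximal_clique_in U X0 : clique X0 -> X0 `<=` U ->
  exists X, [/\ clique X, X0 `<=` X, X `<=` U
    & forall Z, clique Z -> X `<=` Z -> Z `<=` U -> Z = X].
Proof.
(* Zorn's lemma also covers the empty chain, whose union need not contain [X0]. Therefore [P] speaks
   of the union of [Z] with [X0]; a maximal [Z] then contains [X0]. *)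
move=> c0 U0; pose P Z := clique (Z `|` X0) /\ Z `<=` U.
have [|X [[cX XU] mX]] := @Zorn_bigcup _ P.
  move=> F FP tot; split=> [x y|x [Z /FP[_ ZU] /ZU]//].
  have one Z x0 y0 : F Z -> (Z `|` X0) x0 -> (Z `|` X0) y0 -> x0 <> y0 -> adj x0 y0.
    by move=> /FP[+ _]; apply.
  move=> [[Z1 F1 x1]|x1] [[Z2 F2 y2]|y2].
  - case: (tot _ _ F1 F2) => sub; [apply: (one Z2)|apply: (one Z1)] => //; left => //.
      exact: sub.
    exact: sub.
  - by apply: (one Z1) => //; [left|right].
  - by apply: (one Z2) => //; [right|left].
  - exact: c0.
have X0X : X0 `<=` X.
  apply: contrapT => n; apply: (mX (X `|` X0)).
    by split; [left|move=> h; apply: n => x ?; apply: h; right].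
  split; first by rewrite -setUA setUid.
  by rewrite subUset.
exists X; split=> // [|Z cZ XZ ZU].
  by move: cX; rewrite setUidl.
apply/seteqP; split=> //; apply: contrapT => n; apply: (mX Z) => //.
split=> //; rewrite setUidl //; exact: subset_trans XZ.
Qed.

Lemma maximal_clique_ext X0 : clique X0 ->
  exists2 X, maximal_clique X & X0 `<=` X.
Proof.
move=> c0; have [X [cX sX _ mX]] := maximal_clique_in c0 (@subsetT _ X0).
by exists X => //; split=> // Y cY XY; exact: mX.
Qed.

(** Cut off the component of [G - X] that contains some [y] in [Y] but not in [X]: by maximality of
    [X], no vertex of that component is complete to [X]. The strict inclusion bounds the order of
    efficient separations below the size of [X]. *)
Lemma maximal_clique_separation X Y : locally_finite G -> chordal G ->
  maximal_clique X -> maximal_clique Y -> X <> Y ->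
  exists p, [/\ is_oriented_separation p, X `<=` p.1, Y `<=` p.2 & p.1 `&` p.2 `<` X].
Proof.
move=> lf chG [cX mX] [cY mY] XY.
have [y [Yy nXy]] : exists y, Y y /\ ~ X y.
  apply: contrapT => /forallNP h; apply: XY; apply: mY => // z Yz.
  by apply: contrapT => nz; apply: (h z).
have [|p [Hp pY pX pz]] := component_separation lf chG cX cY Yy nXy.
  move=> u yu uX; have nXu := linked_in yu nXy.
  apply: nXu; rewrite -(mX (u |` X)); [by left| |by right].
  move=> a b [->|Xa] [->|Xb] // ab; [exact: uX|exact/adj_sym/uX|exact: cX].
exists p; split=> // z Xz; apply: pz => /linked_in /(_ nXy); exact.
Qed.

End Chordal.

(** * The tree of a nested set of separations *)

Section SepOrder.
Variable V : Type.
Implicit Types p q r : set V * set V.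

Lemma sep_le_refl p : sep_le p p.
Proof. by split. Qed.

Lemma sep_le_trans p q r : sep_le p q -> sep_le q r -> sep_le p r.
Proof. by move=> [a b] [c d]; split; [exact: subset_trans c|exact: subset_trans b]. Qed.

Lemma sep_le_anti p q : sep_le p q -> sep_le q p -> p = q.
Proof.
by case: p q => [A B] [C D] [/= a b] [/= c d]; congr (_, _); apply/seteqP; split.
Qed.

Lemma sep_le_flip p q : sep_le p q -> sep_le (flip q) (flip p).
Proof. by case. Qed.

Lemma sep_le_flipl p q : sep_le (flip p) q -> sep_le (flip q) p.
Proof. by case. Qed.

Lemma sep_le_flipr p q : sep_le p (flip q) -> sep_le q (flip p).
Proof. by case. Qed.

Lemma nested_cases p q : nested (unorient p) (unorient q) ->
  [\/ sep_le p q, sep_le q p, sep_le p (flip q) | sep_le (flip q) p].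
Proof.
case=> p' [q' [/unorient_eq[->|->] /unorient_eq[->|->]]]; rewrite ?flipK => -[] h.
- by constructor 1.
- by constructor 2.
- by constructor 3.
- by constructor 4.
- by constructor 4; apply: sep_le_flipl; rewrite flipK.
- by constructor 3; apply: sep_le_flipr; rewrite flipK.
- by constructor 2; move: h => [].
- by constructor 1; move: h => [].
Qed.

End SepOrder.

Lemma node_eq (V : Type) (N : set (set (set V))) (t u : node N) :
  sval t = sval u -> t = u.
Proof.
case: t u => [s hs] [r hr] /= E; subst r; congr exist; exact: Prop_irrelevance.
Qed.

Section SepTree.
Variables (G : sgraph) (N : set (set (set G))).
Hypothesis conG : connected G.
Hypothesis nestedN : nested_set N.
Hypothesis sepN : forall p, N (unorient p) -> is_oriented_separation p.
Hypothesis properN : forall p, N (unorient p) -> ~ p.1 `<=` p.2.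
Hypothesis pfinN : forall v, finite_set [set p | [/\ N (unorient p), p.1 v & p.2 v]].
Implicit Types (p q r : set G * set G) (t u : sep_tree N).

Let NN p := N (unorient p).

Let NNf p : NN p -> NN (flip p). Proof. by rewrite /NN unorient_flip. Qed.

Let NNfK p : NN (flip p) -> NN p. Proof. by rewrite /NN unorient_flip. Qed.

Lemma flip_neq p : NN p -> flip p <> p.
Proof. by case: p => A B /properN /= h [E _]; apply: h; rewrite E. Qed.

Lemma not_le_flip p : NN p -> ~ sep_le p (flip p).
Proof. by move=> /properN h [/h]. Qed.

Lemma not_flip_le p : NN p -> ~ sep_le (flip p) p.
Proof. by move=> /NNf /properN h [/h]. Qed.

(** Otherwise both sides of [p] lie in [q.1], which is then everything, and [q] is not proper. *)
Lemma not_le2 p q : NN p -> NN q -> sep_le p q -> ~ sep_le (flip p) q.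
Proof.
move=> Np Nq [a _] [b _]; apply: (properN (NNf Nq)) => x _.
by case: (separation_cover x (sepN Np)) => [/a|/b].
Qed.

Lemma not_ge2 p q : NN p -> NN q -> sep_le q p -> ~ sep_le q (flip p).
Proof.
move=> Np Nq h1 h2; apply: (not_le2 Np (NNf Nq) (sep_le_flipr h2)).
exact: sep_le_flip.
Qed.

(** Each such separation has a vertex of a fixed walk from [x] to [y] in its separator, so
    point-finiteness applies to the finitely many vertices of that walk. *)
Lemma finite_between x y : finite_set [set p | [/\ NN p, p.1 x & p.2 y]].
Proof.
case: conG => _ /(_ x y I I); elim=> [u v [_ _ uv]|u|u v w _ IH1 _ IH2].
- have fU : finite_set ([set p | [/\ NN p, p.1 u & p.2 u]] `|` [set p | [/\ NN p, p.1 v & p.2 v]]).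
    by rewrite finite_setU.
  apply: sub_finite_set fU => p [Np pu pv]; have [p2u|np2u] := pselect (p.2 u).
    by left.
  by right; split=> //; exact: (separation_step (sepN Np) uv).
- exact: pfinN.
- have fU : finite_set ([set p | [/\ NN p, p.1 u & p.2 v]] `|` [set p | [/\ NN p, p.1 v & p.2 w]]).
    by rewrite finite_setU.
  apply: sub_finite_set fU => p [Np pu pw].
  by case: (separation_cover v (sepN Np)) => ?; [right|left].
Qed.

Lemma separator_neq0 p : NN p -> exists x, p.1 x /\ p.2 x.
Proof.
move=> Np; have /existsNP[x /not_implyP[px npx]] := properN Np.
have /existsNP[y /not_implyP[py npy]] := properN (NNf Np).
have [z [_ z1 z2]] := separation_link (sepN Np) (conG.2 x y I I) I px py.
by exists z.
Qed.

(** The down-closure of the node in [N]. It recovers the orientation that defines the node, because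
    every element of that orientation lies below a maximal one. *)
Definition node_orientation t : set (set G * set G) :=
  [set p | NN p /\ exists2 q, sval t q & sep_le p q].

Local Notation Or := node_orientation.

Lemma node_orientationE t O : is_orientation N O -> consistent O ->
  (forall p, O p -> exists2 q, maximal_elements O q & sep_le p q) ->
  sval t = maximal_elements O -> Or t = O.
Proof.
move=> [ON Ou] Oc Om tE; apply/seteqP; split=> p.
  move=> [Np [q]]; rewrite tE => -[Oq _] pq; have [r [[Or_ pr] _]] := Ou _ Np.
  case: (unorient_eq pr) => E; first by rewrite E.
  case: (pselect (unorient r = unorient q)) => [rq|rq]; last first.
    by case: (Oc r q Or_ Oq rq); rewrite E in pq.
  have Nr := ON _ Or_.
  case: (unorient_eq rq) => E'; last by rewrite E E' flipK.
  by case: (not_flip_le (ON _ Oq)); rewrite -{1}E' -E.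
move=> Op; split; first exact: ON.
by rewrite tE; exact: Om.
Qed.

Lemma node_orientation_spec t : [/\ is_orientation N (Or t), consistent (Or t)
  & sval t = maximal_elements (Or t)].
Proof.
have [O [h1 h2 h3 h4]] := svalP t.
by rewrite (node_orientationE h1 h2 h3 h4).
Qed.

Lemma orientation_sub t p : Or t p -> NN p.
Proof. by case. Qed.

Lemma orientation_total t p : NN p -> Or t p \/ Or t (flip p).
Proof.
move=> Np; have [[_ H] _ _] := node_orientation_spec t.
have [q [[Oq /unorient_eq[->|->]] _]] := H _ Np; first by left.
by right; rewrite flipK.
Qed.

Lemma orientation_flip t p : Or t p -> ~ Or t (flip p).
Proof.
move=> Op Of; have [[_ H] _ _] := node_orientation_spec t.
have [q [_ uq]] := H _ (orientation_sub Op).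
apply: (flip_neq (orientation_sub Op)).
have <- : q = flip p by apply: uq; rewrite unorient_flip.
exact: uq.
Qed.

Lemma orientation_le t p q : NN p -> sep_le p q -> Or t q -> Or t p.
Proof.
move=> Np pq [_ [r tr qr]]; split=> //; exists r => //; exact: sep_le_trans qr.
Qed.

Lemma node_sub t p : sval t p -> Or t p.
Proof. by case: (node_orientation_spec t) => _ _ -> []. Qed.

Lemma node_max t p q : sval t p -> Or t q -> sep_le p q -> q = p.
Proof. by case: (node_orientation_spec t) => _ _ -> [_]; apply. Qed.

Lemma orientation_inj t u : Or t `<=` Or u -> t = u.
Proof.
move=> tu; have E : Or t = Or u.
  apply/seteqP; split=> // p pu.
  by case: (orientation_total t (orientation_sub pu)) => // /tu /(orientation_flip pu).
apply: node_eq; case: (node_orientation_spec t) => _ _ ->.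
by case: (node_orientation_spec u) => _ _ ->; rewrite E.
Qed.

Lemma bagP t v : sep_bag t v <-> forall p, Or t p -> p.2 v.
Proof.
split=> [h p [_ [q tq [_ qp]]]|h p tp]; first exact/qp/h.
exact/h/node_sub.
Qed.

(** Distinct elements [p] and [q] of a node satisfy [sep_le p (flip q)], since the other ways of
    being nested contradict maximality or consistency. Hence [p.1] lies in [q.2]. *)
Lemma separator_sub_bag t p : sval t p -> p.1 `&` p.2 `<=` sep_bag t.
Proof.
move=> tp z [z1 z2] q tq; have Op := node_sub tp; have Oq := node_sub tq.
have := nestedN (orientation_sub Op) (orientation_sub Oq) => /nested_cases[h|h|h|h].
- by rewrite (node_max tp Oq h).
- by rewrite -(node_max tq Op h).
- exact: h.1.
- have := orientation_le (NNf (orientation_sub Oq)) h Op.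
  by move=> /(orientation_flip Oq).
Qed.

Lemma bag_neq0 t : sep_bag t !=set0.
Proof.
have [[p tp]|h] := pselect (exists p, sval t p).
  have [z hz] := separator_neq0 (orientation_sub (node_sub tp)).
  by exists z; exact: (separator_sub_bag tp).
by case: conG => -[v _] _; exists v => p tp; case: h; exists p.
Qed.

(** The only candidate for an orientation in which [p] is maximal: everything below [p], and
    everything strictly below its reverse. *)
Definition pointing p : set (set G * set G) :=
  [set q | NN q /\ (sep_le q p \/ sep_le q (flip p) /\ q <> flip p)].

(** Maximality of [p] and closure under [sep_le] leave just one way to orient each separation nested
    with [p]. Hence a node is determined by any one of its elements. *)
Lemma orientation_pointing t p : sval t p -> Or t = pointing p.
Proof.
move=> tp; have Op := node_sub tp; have Np := orientation_sub Op.
apply/seteqP; split=> q.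
  move=> Oq; have Nq := orientation_sub Oq; split=> //.
  have := nestedN Nq Np => /nested_cases[h|h|h|h].
  - by left.
  - by left; rewrite (node_max tp Oq h); exact: sep_le_refl.
  - by right; split=> // E; apply: (orientation_flip Op); rewrite -E.
  - by case: (orientation_flip Op); exact: orientation_le (NNf Np) h Oq.
move=> [Nq [h|[h nE]]]; first exact: orientation_le h Op.
case: (orientation_total t Nq) => // Of; case: nE.
by rewrite -(node_max tp Of (sep_le_flipr h)) flipK.
Qed.

Lemma node_inj t u p : sval t p -> sval u p -> t = u.
Proof.
move=> /orientation_pointing E /orientation_pointing E'.
by apply: orientation_inj; rewrite E E'.
Qed.

Lemma pointing_orientation p : NN p -> is_orientation N (pointing p).
Proof.
move=> Np; split=> [q []//|s Ns].
have [q sE] : exists q, s = unorient q.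
  by have [q [_ [sq _ _]]] := nestedN Ns Ns; exists q.
rewrite {s}sE in Ns *; have nb r : pointing p r -> pointing p (flip r) -> False.
  move=> [Nr [h|[h h']]] [_ [k|[k k']]].
  - exact: (not_le2 Nr Np h k).
  - have E : r = p by apply: sep_le_anti h _; case: k.
    by apply: k'; rewrite E.
  - apply: h'; apply: sep_le_anti h _; move: (sep_le_flip k); by rewrite flipK.
  - exact: (not_le2 Nr (NNf Np) h k).
have [r [Or_ Er]] : exists r, pointing p r /\ unorient q = unorient r.
  have := nestedN Ns Np => /nested_cases[h|h|h|h].
  - by exists q; split=> //; split=> //; left.
  - have [E|E] := pselect (q = p).
      by exists q; split=> //; split=> //; left; rewrite E; exact: sep_le_refl.
    exists (flip q); rewrite unorient_flip; split=> //; split; first exact: NNf.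
    by right; split; [exact: sep_le_flip|move=> /(congr1 (@flip _)); rewrite !flipK].
  - have [E|E] := pselect (q = flip p).
      exists p; split; last by rewrite E unorient_flip.
      by split=> //; left; exact: sep_le_refl.
    by exists q; split=> //; split=> //; right.
  - exists (flip q); rewrite unorient_flip; split=> //; split; first exact: NNf.
    by left; exact: sep_le_flipl.
exists r; split=> // r' [Or' Er'].
have [//|E] := unorient_eq (etrans (esym Er) Er').
by exfalso; apply: (nb r') => //; rewrite -E.
Qed.

Lemma pointing_consistent p : NN p -> consistent (pointing p).
Proof.
move=> Np q r [Nq hq] [Nr hr] _ qr.
case: hq hr => [hq|[hq nq]] [hr|[hr nr]].
- exact: (not_le2 Nq Np hq (sep_le_trans qr hr)).
- apply: nr; apply: sep_le_anti hr _; apply: sep_le_trans qr; exact: sep_le_flip.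
- apply: nq; apply: sep_le_anti hq _; apply: sep_le_flipl.
  exact: sep_le_trans qr hr.
- exact: (not_le2 Nq (NNf Np) hq (sep_le_trans qr hr)).
Qed.

Lemma pointing_top p : NN p -> maximal_elements (pointing p) p.
Proof.
move=> Np; split=> [|q [Nq [h|[h _]]] pq].
- by split=> //; left; exact: sep_le_refl.
- exact: sep_le_anti.
- by case: (not_le_flip Np (sep_le_trans pq h)).
Qed.

Lemma pointing_maximal p q : NN p -> pointing p q ->
  exists2 r, maximal_elements (pointing p) r & sep_le q r.
Proof.
move=> Np [Nq [h|[h nE]]]; first by exists p => //; exact: pointing_top.
pose S := [set r | [/\ NN r, sep_le q r, sep_le r (flip p) & r <> flip p]].
(* Every [r] between [q] and [flip p] has [x] in [r.1] and [y] in [r.2], so there are only finitely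
   many and one of them is maximal. *)
have [x [qx _]] := separator_neq0 Nq; have [y [py _]] := separator_neq0 Np.
have Sf : finite_set S.
  apply: sub_finite_set (finite_between x y) => r [Nr [a _] [_ b] _].
  by split=> //; [exact: a|exact: b].
have [|r [[Nr qr rp rn] _ rm]] := finite_maximal (le := @sep_le G) (x := q) (@sep_le_trans _)
  (@sep_le_anti _) (@sep_le_refl _) Sf; first by split=> //; exact: sep_le_refl.
exists r => //; split; first by split=> //; right.
move=> r' [Nr' hr'] rr'; apply: rm (rr') => //; split=> //.
- exact: sep_le_trans rr'.
- case: hr' => [k|[]//]; case: (not_ge2 Np Nr _ rp); exact: sep_le_trans k.
- case: hr' => [k|[]//]; case: (not_ge2 Np Nr _ rp); exact: sep_le_trans k.
Qed.

Lemma pointing_node p : NN p -> exists t, sval t p.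
Proof.
move=> Np; have H : is_node N (maximal_elements (pointing p)).
  exists (pointing p); split=> //; first exact: pointing_orientation.
    exact: pointing_consistent.
  by move=> q; exact: pointing_maximal.
by exists (exist _ _ H); exact: pointing_top.
Qed.

(** The neighbours of a node arise by reversing one maximal element of its orientation and leaving
    everything else unchanged. *)
Lemma flip_node t p : sval t p -> exists u, [/\ adj t u, sval u (flip p)
  & forall q, Or u q <-> (Or t q /\ q <> p) \/ q = flip p].
Proof.
move=> tp; have Op := node_sub tp; have Np := orientation_sub Op.
have [u up] := pointing_node (NNf Np); exists u.
have E q : Or u q <-> (Or t q /\ q <> p) \/ q = flip p.
  rewrite (orientation_pointing tp) (orientation_pointing up) /pointing /= flipK.
  split=> [[Nq [h|[h nE]]]|[[[Nq [h|[h nE]]] nq]|->]].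
  - have [?|?] := pselect (q = flip p); first by right.
    left; split; first by split=> //; right.
    by move=> E; apply: (not_le_flip Np); rewrite -{1}E.
  - by left; split=> //; split=> //; left.
  - by split=> //; right.
  - by split=> //; left.
  - by split; [exact: NNf|left; exact: sep_le_refl].
split=> //; split.
  by move=> tu; apply: (orientation_flip Op); rewrite tu; exact: node_sub.
by exists p.1, p.2; split=> //; case: (p) tp.
Qed.

(** The orientations of adjacent nodes differ only on the separation of their common edge, so [p]
    must orient that separation. *)
Lemma adj_cross t u p : adj t u -> Or t (flip p) -> Or u p ->
  sval u p /\ sval t (flip p).
Proof.
move=> [_ [A [B [_ tAB uBA]]]] tp up.
have [u' [_ u'BA E]] := flip_node tAB.
have uu : u = u' by exact: node_inj uBA u'BA.
rewrite uu in up uBA; have [[tp' _]|->] := (E _).1 up; last by rewrite uu.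
by case: (orientation_flip tp').
Qed.

(* Flip one maximal element of the orientation at a time until no separation in
   [R] is left. *)
Lemma node_descent (R : set (set G * set G)) (W : set G) t :
  (forall p q, NN p -> NN q -> R p -> sep_le p q -> R q) ->
  (forall p, NN p -> R p -> ~ R (flip p)) ->
  (forall p, NN p -> R p -> W `<=` p.1) ->
  W `<=` sep_bag t -> finite_set (Or t `&` R) ->
  exists u, [/\ W `<=` sep_bag u, forall p, Or u p -> ~ R p
    & linked [set u | W `<=` sep_bag u] t u].
Proof.
move=> Rle Rf RW Wt; have [S SE] : exists S, Or t `&` R = S by exists (Or t `&` R).
rewrite SE => Sf; move: S Sf t Wt SE; refine (finite_proper_ind _) => S Sf IH t Wt SE.
have [[p [tp Rp]]|no] := pselect (exists p, Or t p /\ R p); last first.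
  exists t; split=> // [p tp Rp|]; first by apply: no; exists p.
  exact: rt_refl.
have [Np [q tq pq]] := tp; have Oq := node_sub tq; have Nq := orientation_sub Oq.
have Rq : R q by exact: Rle pq.
have [u [tu _ uE]] := flip_node tq.
have Wu : W `<=` sep_bag u.
  move=> v Wv; apply/bagP => r /uE[[tr _]|->]; last exact: RW Wv.
  by move: r tr; apply/bagP; exact: Wt.
have [|w [Ww wR uw]] := IH _ _ u Wu (erefl _).
  rewrite -SE; split=> [r [/uE[[tr _]|->] Rr]|/(_ q (conj Oq Rq))[/uE[[_ //]|E] _]].
  - by split.
  - by case: (Rf _ Nq Rq).
  - by case: (flip_neq Nq).
exists w; split=> //; apply: rt_trans uw; exact: rt_step.
Qed.

(** Descend from [t] by reversing the separations that [u] orients differently; a vertex from each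
    of the two bags shows that these are finitely many. Empty [W] gives connectedness of the tree,
    and a singleton gives connectedness of the subtree of a vertex. *)
Lemma bags_linked (W : set G) t u : W `<=` sep_bag t -> W `<=` sep_bag u ->
  linked [set t | W `<=` sep_bag t] t u.
Proof.
move=> Wt Wu.
have [v tv] := bag_neq0 t; have [w uw] := bag_neq0 u.
pose R := [set p | Or u (flip p)].
have [|||//||u' [_ u'R tu']] := @node_descent R W t.
- move=> p q Np Nq up pq; apply: orientation_le up; first exact: NNf.
  exact: sep_le_flip.
- by move=> p Np up /(orientation_flip up).
- by move=> p Np up x /Wu/bagP/(_ _ up).
- apply: sub_finite_set (finite_between w v) => p [tp up].
  split; first exact: orientation_sub tp.
    by move/bagP: uw => /(_ _ up).
  by move/bagP: tv => /(_ _ tp).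
suff <- : u' = u by [].
apply: orientation_inj => p u'p; have Np := orientation_sub u'p.
by case: (orientation_total u Np) => // /(u'R _ u'p).
Qed.

Lemma exists_node : exists t : sep_tree N, True.
Proof.
have [[p Np]|no] := pselect (exists p, NN p).
  by have [t _] := pointing_node Np; exists t.
have N0 s : ~ N s.
  by move=> Ns; have [q [_ [sq _ _]]] := nestedN Ns Ns; apply: no; exists q; rewrite /NN -sq.
have H : is_node N (maximal_elements set0).
  exists set0; split=> //.
  by split=> // s /N0.
by exists (exist _ _ H).
Qed.

(** A clique lies on one side of every separation. Descend from any node by reversing the
    separations that do not point towards [K], until none is left. *)
Lemma clique_in_bag (K : set G) : clique K -> K !=set0 ->
  exists t, K `<=` sep_bag t.
Proof.
move=> cK [k Kk].
have side p : NN p -> ~ K `<=` p.2 -> K `<=` p.1.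
  move=> Np /existsNP[x /not_implyP[Kx nx]] y Ky.
  have px : p.1 x by case: (separation_cover x (sepN Np)).
  have [<- //|xy] := pselect (x = y).
  exact: (separation_step (sepN Np) (cK _ _ Kx Ky xy)).
pose R := [set p : set G * set G | ~ K `<=` p.2].
have [t _] := exists_node; have [v tv] := bag_neq0 t.
have [|||||u [_ uR _]] := @node_descent R set0 t.
- by move=> p q Np Nq Rp [_ qp] Kq; apply: Rp; exact: subset_trans qp.
- by move=> p Np /(side _ Np) h nh; apply: nh.
- by move=> p _ _; exact: sub0set.
- exact: sub0set.
- apply: sub_finite_set (finite_between k v) => p [tp Rp].
  have Np := orientation_sub tp.
  split=> //; first exact: side Rp _ Kk.
  by move/bagP: tv => /(_ _ tp).
exists u => x Kx; apply/bagP => p up.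
by have /contrapT := uR p up; apply.
Qed.

(** Let [(A, B)] belong to the edge from [c 0] to [c 1]. Along the rest of the cycle the orientation
    [(B, A)] persists, since it can be reversed only between the unique nodes containing [(B, A)]
    and [(A, B)], which are [c 1] and [c 0]. So the cycle cannot return to [c 0]. *)
Lemma sep_tree_acyclic n (c : 'I_n -> sep_tree N) : ~ is_cycle c.
Proof.
case=> n3 cinj cadj; case: n n3 c cinj cadj => [|[|[|n]]] // _ c cinj cadj.
have cS k : k.+1 < n.+3 -> adj (c (inord k)) (c (inord k.+1)).
  move=> kn; have -> : inord k.+1 = ordS (inord k : 'I_n.+3).
    apply: val_inj; apply: etrans (esym (val_ordS _)).
    by rewrite /= !inordK // ?kn // ltnW.
  exact: cadj.
have cneq j k : j < n.+3 -> k < n.+3 -> c (inord j) = c (inord k) -> j = k.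
  by move=> jn kn /cinj /(congr1 val) /=; rewrite !inordK.
have [_ [A [B [_ c0 c1]]]] := cS 0 isT.
have H k : k < n.+2 -> Or (c (inord k.+1)) (flip (A, B)).
  elim: k => [|k IH] kn; first exact: node_sub c1.
  have ck := IH (ltnW kn).
  have NAB := NNfK (orientation_sub ck).
  case: (orientation_total (c (inord k.+2)) NAB) => // ck2.
  have [h _] := adj_cross (cS k.+1 kn) ck ck2.
  by have := cneq _ _ _ _ (node_inj h c0) => /(_ kn isT).
have cn : adj (c (inord n.+2)) (c (inord 0)).
  have -> : inord 0 = ordS (inord n.+2 : 'I_n.+3).
    by apply: val_inj; apply: etrans (esym (val_ordS _)); rewrite /= !inordK // ltnn.
  exact: cadj.
have [_ h] := adj_cross cn (H n.+1 (ltnSn _)) (node_sub c0).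
by have := cneq _ _ _ _ (node_inj h c1) => /(_ (ltnSn _) isT).
Qed.

Theorem sep_tree_decomposition : tree_decomposition (@sep_bag G N).
Proof.
split.
- split; last exact: sep_tree_acyclic.
  split; first by have [t _] := exists_node; exists t.
  move=> t u _ _; apply: (@linked_sub _ [set t | set0 `<=` sep_bag t]) => //.
  exact: bags_linked.
- move=> v; have [||t vt] := @clique_in_bag [set v]; last by exists t; exact: vt.
    by move=> x y -> ->.
  by exists v.
- move=> x y xy; have [||t vt] := @clique_in_bag [set x; y].
  + by move=> a b [->|->] [->|->] //; move/adj_sym: xy.
  + by exists x; left.
  by exists t; split; apply: vt; [left|right].
- move=> v; split=> [|t u tv uv].
    have [||t vt] := @clique_in_bag [set v]; last by exists t; exact: vt.
      by move=> x y -> ->.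
    by exists v.
  apply: (@linked_sub _ [set t | [set v] `<=` sep_bag t]).
    by move=> w h; exact: h.
  by apply: bags_linked => x ->.
Qed.

End SepTree.
(** * The action of the automorphism group *)

Section Action.
Variables (G : sgraph) (N : set (set (set G))).
Hypothesis invN : aut_invariant N.
Implicit Types (p q : set G * set G) (S : set (set G * set G)).

Definition osep_image (phi : G -> G) p : set G * set G := (phi @` p.1, phi @` p.2).

Lemma unorient_image phi p :
  unorient (osep_image phi p) = sep_image phi (unorient p).
Proof. by rewrite /sep_image /unorient image_setU !image_set1. Qed.

Lemma automorphism_inverse (phi : G -> G) : automorphism phi ->
  exists psi, [/\ automorphism psi, cancel phi psi & cancel psi phi].
Proof.
move=> [[psi k1 k2] h]; exists psi; split=> //; split; first by exists phi.
by move=> x y; rewrite -h !k2.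
Qed.

Lemma automorphism_comp (phi psi : G -> G) :
  automorphism phi -> automorphism psi -> automorphism (phi \o psi).
Proof.
move=> [b h] [b' h']; split; first exact: bij_comp.
by move=> x y; rewrite /= h h'.
Qed.

Lemma osep_imageK phi psi : cancel phi psi ->
  cancel (osep_image phi) (osep_image psi).
Proof.
move=> k [A B]; rewrite /osep_image /= !image_comp.
by rewrite (_ : psi \o phi = id) ?image_id //; apply/funext.
Qed.

Lemma osep_image_le phi p q : sep_le p q ->
  sep_le (osep_image phi p) (osep_image phi q).
Proof. by move=> [h h']; split; exact: image_subset. Qed.

Lemma image_node phi S : automorphism phi -> is_node N S ->
  is_node N (osep_image phi @` S).
Proof.
move=> aphi; have [psi [apsi k1 k2]] := automorphism_inverse aphi.
have K1 := osep_imageK k1; have K2 := osep_imageK k2.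
have leE p q : sep_le (osep_image phi p) q -> sep_le p (osep_image psi q).
  by move=> /(osep_image_le psi); rewrite K1.
have N1 p : N (unorient p) -> N (unorient (osep_image phi p)).
  by rewrite unorient_image; exact: invN.
have im_max O p : maximal_elements O p ->
    maximal_elements (osep_image phi @` O) (osep_image phi p).
  move=> [Op mp]; split=> [|_ [q Oq <-] h]; first by exists p.
  by congr osep_image; apply: mp => //; have := leE _ _ h; rewrite K1.
move=> [O [[ON Ou] Oc Om ->]]; exists (osep_image phi @` O); split.
- split=> [_ [p Op <-]|s Ns]; first exact/N1/ON.
  have [p [[Op sp] pu]] := Ou _ (invN apsi Ns).
  have sE : s = sep_image phi (sep_image psi s).
    rewrite /sep_image image_comp (_ : _ \o _ = id) ?image_id //.
    apply/funext => A /=; rewrite image_comp (_ : phi \o psi = id) ?image_id //.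
    exact/funext.
  exists (osep_image phi p); split.
    by split; [exists p|rewrite unorient_image -sp].
  move=> _ [[q Oq <-] sq]; congr osep_image; apply: pu; split=> //.
  by rewrite sq -unorient_image K1.
- move=> _ _ [p Op <-] [q Oq <-] pq h; apply: (Oc p q Op Oq).
    by move=> E; apply: pq; rewrite !unorient_image E.
  by have := leE (p.2, p.1) _ h; rewrite K1.
- move=> _ [p Op <-]; have [q mq pq] := Om _ Op.
  by exists (osep_image phi q); [exact: im_max|exact: osep_image_le].
- apply/seteqP; split=> [_ [p mp <-]|q [[p Op <-] mp]]; first exact: im_max.
  exists p => //; split=> // r Or_ pr.
  apply: (can_inj K1); apply: mp; first by exists r.
  exact: osep_image_le.
Qed.

(** Maps that are not automorphisms act as the identity by default, because only automorphisms are
    known to map nodes to nodes. *)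
Definition node_act (phi : G -> G) (t : sep_tree N) : sep_tree N :=
  match pselect (automorphism phi) with
  | left a => exist _ (osep_image phi @` sval t) (image_node a (svalP t))
  | right _ => t
  end.

Lemma node_actE phi t : automorphism phi ->
  sval (node_act phi t) = osep_image phi @` sval t.
Proof. by rewrite /node_act; case: pselect. Qed.

Lemma osep_image_id : osep_image idfun = id.
Proof. by apply/funext => -[A B]; rewrite /osep_image /= !image_id. Qed.

Lemma node_act_comp phi psi t : automorphism phi -> automorphism psi ->
  node_act (phi \o psi) t = node_act phi (node_act psi t).
Proof.
move=> a b; apply: node_eq; rewrite !node_actE //; last exact: automorphism_comp.
rewrite image_comp; congr image; apply/funext => p.
by rewrite /osep_image /= !image_comp.
Qed.

Lemma automorphism_id : automorphism (idfun : G -> G).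
Proof. by split=> //; exists id. Qed.

Lemma node_act_id t : node_act idfun t = t.
Proof.
apply: node_eq; rewrite node_actE; last exact: automorphism_id.
by rewrite osep_image_id image_id.
Qed.

Lemma node_actK phi psi : automorphism phi -> automorphism psi ->
  cancel phi psi -> cancel (node_act phi) (node_act psi).
Proof.
move=> a b k t; rewrite -node_act_comp //.
by rewrite (_ : psi \o phi = idfun) ?node_act_id //; apply/funext.
Qed.

Lemma node_act_adj phi t u : automorphism phi -> adj t u ->
  adj (node_act phi t) (node_act phi u).
Proof.
move=> a [tu [A [B [NAB tAB uBA]]]]; have [psi [b k1 k2]] := automorphism_inverse a.
split; first by move=> /(can_inj (node_actK a b k1)).
exists (phi @` A), (phi @` B); rewrite !node_actE //; split.
- have := invN a NAB; rewrite -[[set A; B]]/(unorient (A, B)).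
  by rewrite -unorient_image.
- by exists (A, B).
- by exists (B, A).
Qed.

Theorem sep_tree_canonical : canonical_decomposition (@sep_bag G N).
Proof.
exists node_act; split.
- move=> phi a; have [psi [b k1 k2]] := automorphism_inverse a.
  split; first by exists (node_act psi); exact: node_actK.
  move=> t u; split; last exact: node_act_adj.
  by move=> /(node_act_adj b); rewrite !(node_actK a b k1).
- exact: node_act_id.
- by move=> phi psi a b t; exact: node_act_comp.
- move=> phi a t; have [psi [b k1 k2]] := automorphism_inverse a.
  apply/seteqP; split=> x.
    move=> h; exists (psi x) => // p tp.
    have /h[y py xy] : sval (node_act phi t) (osep_image phi p).
      by rewrite node_actE //; exists p.
    by rewrite -xy k1.
  move=> [y ty <-] r tr; move: (tr); rewrite /= node_actE // => -[p tp <-] /=.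
  by exists y => //; exact: ty.
Qed.

End Action.

(** * Chordality from a tree-decomposition into cliques *)

Section Bridge.
Variables (T : sgraph) (a b : T).

Definition del_adj (x y : T) :=
  [/\ adj x y, ~ (x = a /\ y = b) & ~ (x = b /\ y = a)].

Lemma del_adj_sym x y : del_adj x y -> del_adj y x.
Proof.
move=> [xy h1 h2]; split; first exact: adj_sym.
  by case=> ? ?; apply: h2.
by case=> ? ?; apply: h1.
Qed.

Lemma del_adj_irr x : ~ del_adj x x.
Proof. by move=> [/adj_irr]. Qed.

Definition del_edge : sgraph := SGraph del_adj_sym del_adj_irr.

Lemma linked_del_edge (U : set T) x y : ~ (U a /\ U b) -> linked U x y ->
  linked (G := del_edge) setT x y.
Proof.
move=> nab; elim=> [u v [Uu Uv uv]|u|u v w _ IH1 _ IH2].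
- apply: rt_step; split=> //; split=> // -[E1 E2]; apply: nab; split.
  + by rewrite -E1.
  + by rewrite -E2.
  + by rewrite -E2.
  + by rewrite -E1.
- exact: rt_refl.
- exact: rt_trans IH1 IH2.
Qed.

(** An induced path from [a] to [b] that avoids the edge [ab] has length at least 2, so adding [ab]
    would close it to a cycle. *)
Lemma acyclic_bridge : (forall n (c : 'I_n -> T), ~ is_cycle c) -> adj a b ->
  ~ linked (G := del_edge) setT a b.
Proof.
move=> acyc ab /linked_induced_path/(_ I)[l [q [q0 ql _ qi]]].
have l1 : 1 < l.
  case: l => [|[|l]] // in ql qi *.
    by move: ab; rewrite -q0 -ql; move/adj_irr.
  by case: qi => /(_ 0 isT); rewrite q0 ql => -[_ []].
apply: (acyc l.+1 (fun i => q i)); split=> //.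
  move=> i j /(induced_path_inj qi) E; apply: val_inj; apply: E.
    by rewrite -ltnS.
  by rewrite -ltnS.
move=> i; rewrite val_ordS; have := ltn_ord i; move: (nat_of_ord i) => k kl.
case: ifP => [|kl']; first by move=> kl'; case: qi => /(_ k kl')[].
have -> : k = l by lia.
by rewrite ql q0; exact: adj_sym.
Qed.

End Bridge.

Lemma linked_last_exit (T : sgraph) (U P : set T) x y :
  linked U x y -> U x -> P x -> ~ P y ->
  exists a b, [/\ U a, P a, U b, ~ P b & adj a b /\ linked (U `\` P) b y].
Proof.
move=> /clos_rt_rtn1_iff xy Ux Px; elim: xy => [//|u v [Uu Uv uv] _ IH nPv].
have [Pu|nPu] := pselect (P u).
  by exists u, v; split=> //; split=> //; exact: rt_refl.
have [a [b [? ? ? ? [ab bu]]]] := IH nPu; exists a, b; split=> //; split=> //.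
by apply: rt_trans bu _; apply: rt_step.
Qed.

(* If [c] were a chordless cycle, the subtrees [Tr k] of bags containing [c k]
   would meet cyclically. The edge [ab] where [Tr 1] leaves [Tr 0] towards [Tr 2]
   is then bypassed through [Tr 2, ..., Tr (n-1), Tr 0], hence lies on a cycle. *)
Lemma clique_tree_decomposition_chordal (G T : sgraph) (bag : T -> set G) :
  tree_decomposition bag -> into_cliques bag -> chordal G.
Proof.
move=> [[_ acyc] _ bagE bagC] bagK [|[|[|[|n]]]] // c _ [_ cinj cadj].
apply: contrapT => nch.
pose d k := c (inord k).
pose Tr k := [set t | bag t (d k)].
have dS k : k.+1 < n.+4 -> adj (d k) (d k.+1).
  move=> kn; rewrite /d; have -> : inord k.+1 = ordS (inord k : 'I_n.+4).
    apply: val_inj; apply: etrans (esym (val_ordS _)).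
    by rewrite /= !inordK // ?kn // ltnW.
  exact: cadj.
have dn : adj (d n.+3) (d 0).
  rewrite /d; have -> : inord 0 = ordS (inord n.+3 : 'I_n.+4).
    by apply: val_inj; apply: etrans (esym (val_ordS _)); rewrite /= !inordK // ltnn.
  exact: cadj.
(* Non-consecutive vertices of the chordless cycle share no bag, as bags are cliques. The
   disjunction excludes the pair of [0] and [n.+3], which the closing edge joins. *)
have disj j k t : j.+1 < k -> k < n.+4 -> (0 < j) || (k < n.+3) ->
    Tr j t -> ~ Tr k t.
  move=> jk kn h tj tk; have jn : j < n.+4 by lia.
  apply: nch; exists (inord j), (inord k); split.
  - by move=> /(congr1 val) E; have := etrans E (val_ordS _); rewrite /= !inordK //; case: ifP; lia.
  - by move=> /(congr1 val) E; have := etrans E (val_ordS _); rewrite /= !inordK //; case: ifP; lia.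
  - apply: bagK tj tk _ => /cinj /(congr1 val) /=; rewrite !inordK //; lia.
have meet k : k.+1 < n.+4 -> exists t, Tr k t /\ Tr k.+1 t.
  by move=> /dS /bagE.
have [t0 [t00 t01]] := meet 0 isT; have [t1 [t11 t12]] := meet 1 isT.
have nt1 : ~ Tr 0 t1 by move=> /(disj 0 2) -/(_ isT isT isT).
have [a [b [a1 a0 b1 nb0 [ab bt1]]]] :=
  linked_last_exit ((bagC (d 1)).2 _ _ t01 t11) t01 t00 nt1.
(* Each subtree used misses an end of [ab]: [Tr 2] misses [a], which lies in [Tr 0], and the later
   ones miss [b], which lies in [Tr 1]. *)
have arc k s : 1 < k -> k < n.+4 -> Tr k s -> linked (G := del_edge a b) setT t1 s.
  elim: k s => [//|[//|k] IH] s _ kn sk.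
  case: k => [|k] in IH kn sk *.
    apply: (linked_del_edge _ ((bagC (d 2)).2 _ _ t12 sk)).
    by move=> [/(disj 0 2 _ isT isT isT a0)].
  have [s' [s'1 s'2]] := meet _ kn.
  apply: rt_trans (IH s' isT (ltnW kn) s'1) _.
  apply: (linked_del_edge _ ((bagC (d k.+3)).2 _ _ s'2 sk)) => -[_].
  exact: (disj 1 k.+3 b).
have [s [sn s0]] := bagE _ _ dn.
apply: (acyclic_bridge acyc ab); apply: linked_sym.
apply: (@rt_trans _ _ _ t1); first by apply: linked_del_edge bt1 => -[[_ ha]].
apply: rt_trans (arc n.+3 s isT (ltnSn _) sn) _.
by apply: (linked_del_edge _ ((bagC (d 0)).2 _ _ s0 a0)) => -[].
Qed.

(** * The bags are cliques *)

Section CliqueBags.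
Variables (G : sgraph) (N : set (set (set G))).
Hypothesis lfG : locally_finite G.
Hypothesis conG : connected G.
Hypothesis chG : chordal G.
Hypothesis nestedN : nested_set N.
Hypothesis tightN : forall s, N s -> tight s.
Hypothesis effN : forall X Y, maximal_clique X -> maximal_clique Y -> X <> Y ->
  exists2 s, N s & efficiently_distinguishes s X Y.
Implicit Types (p q : set G * set G) (t : sep_tree N).

Lemma tight_separation p : tight (unorient p) -> is_oriented_separation p.
Proof.
by case=> -[q /unorient_eq[->|->] hq _] //; exact: separation_flip.
Qed.

Lemma tight_proper p : tight (unorient p) -> ~ p.1 `<=` p.2.
Proof.
case=> _ /(_ p.1 p.2 erefl)[C [[x Ux ->] CA _]] h.
by have [/h] := CA x (rt_refl _ _ _).
Qed.

Lemma tight_separators_clique p : N (unorient p) -> clique (p.1 `&` p.2).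
Proof. by move=> /tightN tp; exact: chordal_tight_clique tp _. Qed.

Lemma tight_point_finite v :
  finite_set [set p | [/\ N (unorient p), p.1 v & p.2 v]].
Proof.
apply: (finite_clique_separations (v := v) lfG conG) => p [Np p1 p2]; split=> //.
  exact/tight_separation/tightN.
exact: tight_separators_clique.
Qed.

Let sepN p : N (unorient p) -> is_oriented_separation p.
Proof. by move=> /tightN/tight_separation. Qed.

Let properN p : N (unorient p) -> ~ p.1 `<=` p.2.
Proof. by move=> /tightN/tight_proper. Qed.

Lemma clique_sep_tree_decomposition : tree_decomposition (@sep_bag G N).
Proof. apply: sep_tree_decomposition => //; exact: tight_point_finite. Qed.

(** The separator is itself a clique inside the bag and contains [Z], so maximality of [Z] forces
    equality. *)
Lemma maximal_clique_in_separator t p Z : sval t p ->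
  Z `<=` sep_bag t -> clique Z ->
  (forall Z', clique Z' -> Z `<=` Z' -> Z' `<=` sep_bag t -> Z' = Z) ->
  Z `<=` p.1 -> Z = p.1 `&` p.2.
Proof.
move=> tp Zt cZ mZ Zp; have Np := orientation_sub (node_sub properN tp).
apply/esym/mZ.
- exact: tight_separators_clique.
- by move=> z Zz; split; [exact: Zp|exact: Zt].
- exact: separator_sub_bag tp.
Qed.

(** The contradiction when the bag lies on the side of [Y]: cutting off the component of [y] in
    [G - Z] separates [X] from [Y] with a separator strictly inside [Z], while [Z] lies in the
    separator of the efficient [s]. *)
Lemma bag_side t (X Y Z : set G) (s : set (set G)) p y :
  clique X -> clique Y -> efficiently_distinguishes s X Y ->
  s = unorient p -> node_orientation t p -> X `<=` p.1 ->
  Z `<=` X -> Z `<=` sep_bag t -> clique Z ->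
  (forall Z', clique Z' -> Z `<=` Z' -> Z' `<=` sep_bag t -> Z' = Z) ->
  sep_bag t y -> Y y -> ~ Z y -> False.
Proof.
move=> cX cY [_ _ eff] sE Op Xp ZX Zt cZ mZ ty Yy nZy.
have [Np [q tq pq]] := Op; have Nq := orientation_sub (node_sub properN tq).
have Zq : Z = q.1 `&` q.2.
  by apply: maximal_clique_in_separator tq Zt cZ mZ _ => z /ZX/Xp; exact: pq.1.
(* The vertex [y] lies in the bag, hence in [r.2], and a walk avoiding the separator [Z] of [r]
   cannot get to [r.1]. *)
have avoid r u : sval t r -> Z = r.1 `&` r.2 -> linked (~` Z) y u -> ~ r.1 u.
  move=> tr Zr yu ru; have Nr := orientation_sub (node_sub properN tr).
  have [x [nZx x1 x2]] := separation_link (separation_flip (sepN Nr)) yu nZy (ty _ tr) ru.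
  by apply: nZx; rewrite Zr.
have [|r [Hr Yr rZ rc]] := component_separation lfG chG cZ cY Yy nZy.
  move=> u yu uZ; have nZu : ~ Z u by exact: linked_in yu nZy.
  (* A vertex [u] complete to [Z] contradicts maximality of [Z] if it lies in the bag. Otherwise
     some [r] at the node has [u] strictly behind it; then [Z] lies in [r.1], so [Z] is the
     separator of [r] and cuts [u] off from [y]. *)
  have [tu|ntu] := pselect (sep_bag t u).
    apply: nZu; rewrite -(mZ (u |` Z)); [by left| |by right|].
      move=> x z [->|Zx] [->|Zz] // xz; [exact: uZ|exact/adj_sym/uZ|exact: cZ].
    by move=> x [->|/Zt].
  have [r tr nru] : exists2 r, sval t r & ~ r.2 u.
    by apply: contrapT => h; apply: ntu => r tr; apply: contrapT => n; apply: h; exists r.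
  have Nr := orientation_sub (node_sub properN tr).
  have ru : r.1 u by case: (separation_cover u (sepN Nr)).
  apply: (avoid r u) => //; apply: maximal_clique_in_separator tr Zt cZ mZ _ => z Zz.
  exact: (separation_step (sepN Nr) (uZ _ Zz)).
have Zp : Z `<=` p.1 `&` p.2.
  by move=> z Zz; split; [exact/Xp/ZX|exact/pq.2/(Zt _ Zz)].
apply: (finite_proper_card rZ (finite_clique lfG cZ)).
apply: card_le_trans (subset_card_le Zp) _.
rewrite -!separator_unorient -sE; apply: eff; first by exists r.
exists r.1, r.2; split=> // x Xx; apply: rc => yx.
exact: (avoid q x tq Zq yx (pq.1 _ (Xp _ Xx))).
Qed.

Lemma clique_bags : into_cliques (@sep_bag G N).
Proof.
move=> t x y tx ty xy; apply: contrapT => nxy.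
have c1 (z : G) : clique [set z] by move=> ? ? -> ->.
have s1 z : sep_bag t z -> [set z] `<=` sep_bag t by move=> ? ? ->.
have [Zx [cZx xZx Zxt mZx]] := maximal_clique_in (c1 x) (s1 _ tx).
have [Zy [cZy yZy Zyt mZy]] := maximal_clique_in (c1 y) (s1 _ ty).
have [X mX ZxX] := maximal_clique_ext cZx; have [Y mY ZyY] := maximal_clique_ext cZy.
have Xx : X x by exact/ZxX/xZx.
have Yy : Y y by exact/ZyY/yZy.
have XY : X <> Y by move=> E; apply: nxy; apply: mX.1 => //; rewrite E.
have nZxy : ~ Zx y by move=> h; apply: nxy; apply: cZx => //; exact: xZx.
have nZyx : ~ Zy x by move=> h; apply: nxy; apply: cZy => //; exact: yZy.
have [s Ns es] := effN mX mY XY; have [ss [A [B [sE XA YB]]] smin] := es.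
have NAB : N (unorient (A, B)) by rewrite /unorient /= -sE.
(* If the node orients [s] towards [Y], then [Zx] and [y] give the contradiction; otherwise exchange
   the roles of [X] and [Y]. *)
case: (orientation_total properN t NAB) => Op.
  exact: (bag_side (p := (A, B)) mX.1 mY.1 es sE Op XA ZxX Zxt cZx mZx ty Yy nZxy).
have sw s' : distinguishes s' Y X -> distinguishes s' X Y.
  by move=> [C [D [-> YC XD]]]; exists D, C; rewrite setUC.
have es' : efficiently_distinguishes s Y X.
  split=> //; first by exists B, A; rewrite setUC.
  by move=> s' ? /sw; exact: smin.
apply: (bag_side (p := (B, A)) mY.1 mX.1 es' _ Op YB ZyY Zyt cZy mZy tx Xx nZyx).
by rewrite sE /unorient setUC.
Qed.

End CliqueBags.

(** * Efficient separations of maximal cliques in N(G) *)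

Section Bottlenecks.
Variable bn : forall G : sgraph, nat -> set (set (set (set G))).
Arguments bn : clear implicits.
Hypothesis Hbn : bottleneck_notion bn.
Variable G : sgraph.
Hypothesis lfG : locally_finite G.
Hypothesis conG : connected G.
Hypothesis chG : chordal G.

(** Cutting at [X] and at [Y] yields separations of order less than the sizes of [X] and of [Y]. So
    the efficient separations form a bottleneck, and the construction of N(G) selects an element of
    each bottleneck. *)
Lemma N_all_efficient X Y : maximal_clique X -> maximal_clique Y -> X <> Y ->
  exists2 s, N_all (bn G) s & efficiently_distinguishes s X Y.
Proof.
move=> mX mY XY.
have [p [Hp Xp Yp pX]] := maximal_clique_separation lfG chG mX mY XY.
have [q [Hq Yq Xq qY]] := maximal_clique_separation lfG chG mY mX (nesym XY).
have Xf := finite_clique lfG mX.1; have Yf := finite_clique lfG mY.1.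
have dp : distinguishes (unorient p) X Y by exists p.1, p.2.
have dq : distinguishes (unorient q) X Y by exists q.2, q.1; rewrite /unorient setUC.
have sp : is_separation (unorient p) by exists p.
have sq : is_separation (unorient q) by exists q.
pose P n := exists s, [/\ is_separation s, distinguishes s X Y & separator s #= `I_n].
have Pfin s : is_separation s -> distinguishes s X Y -> finite_set (separator s) ->
    exists n, P n /\ separator s #= `I_n.
  by move=> hs ds /finite_setP[n sn]; exists n; split=> //; exists s.
have pf : finite_set (separator (unorient p)).
  by rewrite separator_unorient; exact: sub_finite_set pX.1 Xf.
have qf : finite_set (separator (unorient q)).
  by rewrite separator_unorient; exact: sub_finite_set qY.1 Yf.
have exP : exists n, `[< P n >].
  by have [n [Pn _]] := Pfin _ sp dp pf; exists n; exact/asboolP.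
have [k /asboolP[s0 [ss0 ds0 s0k]] kmin] := ex_minnP exP.
have small s : is_separation s -> distinguishes s X Y -> finite_set (separator s) ->
    `I_k #<= separator s.
  move=> hs ds /(Pfin _ hs ds)[n [/asboolP/kmin kn sn]].
  by rewrite (card_le_eqr sn) card_le_II.
have effk s : efficiently_distinguishes s X Y -> separator s #= `I_k.
  move=> [hs ds /(_ s0 ss0 ds0) le]; rewrite (card_le_eqr s0k) in le.
  have sf := card_le_finite le (finite_II k).
  by rewrite card_eq_le le; exact: small.
have eff0 : efficiently_distinguishes s0 X Y.
  split=> // s hs ds; rewrite (card_le_eql s0k).
  (* Orders are compared as cardinals, so infinite separators are treated apart: their order exceeds
     every natural number. *)
  have [sf|] := pselect (finite_set (separator s)); first exact: small.
  by move=> /infiniteP; apply: card_le_trans; exact: subset_card_le.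
have nX : ~~ (X #<= `I_k).
  apply/negP => le; apply: (finite_proper_card pX Xf).
  by rewrite -separator_unorient; apply: card_le_trans le _; exact: small.
have nY : ~~ (Y #<= `I_k).
  apply/negP => le; apply: (finite_proper_card qY Yf).
  by rewrite -separator_unorient; apply: card_le_trans le _; exact: small.
have Bb := bn_cliques Hbn lfG chG mX mY XY effk nX nY.
have [s sN] := bn_select_nonempty Hbn lfG conG Bb.
exists s; last by case: sN.
by exists k => //; exists [set s | efficiently_distinguishes s X Y].
Qed.

End Bottlenecks.

Theorem theorem2
    (bn : forall G : sgraph, nat -> set (set (set (set (vertex G)))))
    (Hbn : bottleneck_notion bn)
    (G : sgraph) (HGfin : locally_finite G) (HGconn : connected G) :
  (chordal G <->
     exists (T : sgraph) (bag : vertex T -> set (vertex G)),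
       tree_decomposition bag /\ canonical_decomposition bag /\ into_cliques bag) /\
  (chordal G ->
     let bag := @sep_bag (vertex G) (N_all (bn G)) in
       tree_decomposition bag /\ canonical_decomposition bag /\ into_cliques bag).
Proof.
have H : chordal G -> let bag := @sep_bag (vertex G) (N_all (bn G)) in
    tree_decomposition bag /\ canonical_decomposition bag /\ into_cliques bag.
  move=> chG bag; have [invN nestedN tightN] := bn_N_all Hbn HGfin HGconn.
  split; first exact: clique_sep_tree_decomposition.
  split; first exact: sep_tree_canonical.
  by apply: clique_bags => // X Y; exact: N_all_efficient.
split=> //; split=> [chG|[T [bag [td [_ cl]]]]].
  by exists (sep_tree (N_all (bn G))), (@sep_bag G (N_all (bn G))); exact: H.
exact: clique_tree_decomposition_chordal td cl.
Qed.
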